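(* Any $\varphi$ in $M_3(\mathbb N)$ defines a shift-bounded multiplier on $H^1$. More precisely, for every $\varphi\in M_3(\mathbb N)$, $$\sup_{x\in B_{H^1}}\left\{\int\sup_{k\ge0}\Big|\sum_{n\ge0}\hat x(n)z^n\varphi(n+k)\Big|\,dm(z)\right\}\le\|\varphi\|_{M_3(\mathbb N)} .$$
   Context: $\mathbb N=\{0,1,2,\dots\}$, $\mathbb T$ is the unit circle and $m$ its normalized Lebesgue measure. $H^1$ is the subspace of all $x\in L_1(\mathbb T,m)$ whose Fourier transform $\hat x:\mathbb Z\to\mathbb C$ vanishes on the negative integers; $B_{H^1}$ is its unit ball. One writes $x=\sum_{n\ge0}\hat x(n)z^n$ for the formal Fourier series; $\sum_{n\ge0}\hat x(n)z^n\varphi(n+k)$ denotes the function in $H^1$ having this formal Fourier series (for $\varphi\in M_3(\mathbb N)$ and each $k$, the function $n\mapsto\varphi(n+k)$ defines a bounded multiplier of $H^1$). For $\varphi:\mathbb N\to\mathbb C$, the multiplier $M_\varphi:\sum a_nz^n\mapsto\sum a_n\varphi(n)z^n$ is called shift-bounded on $H^1$ if for every $x\in H^1$, $\int\sup_{k\ge0}|M_\varphi(z^kx)|\,dm=\int\sup_{k\ge0}\big|\sum_{n\ge0}\hat x(n)\varphi(n+k)z^n\big|\,dm<\infty$. For an integer $d\ge1$, $M_d(\mathbb N)$ is the space of all functions $\varphi:\mathbb N\to\mathbb C$ for which there are Hilbert spaces $H_0,\dots,H_d$ with $H_0=H_d=\mathbb C$ and bounded functions $\xi_i:\mathbb N\to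 B(H_i,H_{i-1})$ ($1\le i\le d$) with $\varphi(t_1+\cdots+t_d)=\xi_1(t_1)\xi_2(t_2)\cdots\xi_d(t_d)$ for all $t_1,\dots,t_d\in\mathbb N$ (identifying $B(\mathbb C,\mathbb C)$ with $\mathbb C$). Its norm is $\|\varphi\|_{M_d(\mathbb N)}=\inf\{\sup_{t_1}\|\xi_1(t_1)\|\cdots\sup_{t_d}\|\xi_d(t_d)\|\}$, the infimum over all such representations. *)

(* Defs.v *)
From HB Require Import structures.
From mathcomp Require Import all_boot all_order all_algebra.
From mathcomp Require Import sesquilinear.
From mathcomp Require Import all_classical all_reals all_analysis.
From mathcomp Require Import measurable_realfun.
From mathcomp Require Import complex.

Set Implicit Arguments.
Unset Strict Implicit.
Unset Printing Implicit Defensive.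

Import Order.TTheory GRing.Theory Num.Theory.
Import numFieldNormedType.Exports.

Local Open Scope classical_set_scope.
Local Open Scope complex_scope.
Local Open Scope ring_scope.

(* Norms in a normed space over R[i] take their values in R[i]; this is the
   same norm as an element of R. *)
Definition rnorm (R : realType) (V : normedZmodType R[i]) (x : V) : R :=
  complex.Re `|x|.

Section complex_complete.
Context {R : realType}.
Local Notation C := (R[i]^o).

Lemma rnormE (V : normedZmodType R[i]) (x : V) : (rnorm x)%:C = `|x|.
Proof.
by rewrite /rnorm; have := normr_ge0 x; case: `|x| => a b; rewrite lecE /=
   => /andP[/eqP -> _].
Qed.

Lemma normc_le_ReIm (z : R[i]) :
  `|z| <= (`|complex.Re z| + `|complex.Im z|)%:C.
Proof.
rewrite normc_def lecR -(@ler_pXn2r _ 2) ?nnegrE ?sqrtr_ge0 ?addr_ge0//.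
rewrite sqr_sqrtr ?addr_ge0 ?sqr_ge0// sqrrD !real_normK ?num_real//.
by rewrite addrAC lerDl mulrn_wge0// mulr_ge0.
Qed.

Lemma normc_ge_Im (z : R[i]) : `|complex.Im z|%:C <= `|z|.
Proof.
by case: z => a b; rewrite normc_def lecR /= -sqrtr_sqr ler_wsqrtr// lerDr sqr_ge0.
Qed.

Lemma complex_complete (F : set_system C) : ProperFilter F -> cauchy F -> cvg F.
Proof.
move=> FF Fc.
have Fex (e : R) : 0 < e -> exists x : C, F [set y | `|x - y| < e%:C].
  move=> e0; have e0' : 0 < e%:C :> R[i] by rewrite ltcR.
  by have /cauchyP := Fc; apply.
have cvgp (p : C -> R) : (forall x y, p x - p y = p (x - y)) ->
    (forall z : C, `|p z|%:C <= `|z|) -> exists l : R, p y @[y --> F] --> l.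
  move=> pB ple; suff /cvg_ex : cvg (p y @[y --> F]) by [].
  apply: R_complete; apply/cauchyP => e e0.
  have [x xe] := Fex _ e0; exists (p x).
  change (F (p @^-1` ball (p x) e)).
  apply: filterS xe => y /= xye; rewrite -ball_normE /ball_ /= pB -ltcR.
  exact: le_lt_trans (ple _) xye.
have [a /cvgrPdist_lt Fa] := cvgp (@complex.Re R)
  ltac:(by move=> [? ?] [? ?]) (@normc_ge_Re R).
have [b /cvgrPdist_lt Fb] := cvgp (@complex.Im R)
  ltac:(by move=> [? ?] [? ?]) normc_ge_Im.
apply/cvg_ex; exists (a +i* b : C); apply/cvgrPdist_lt => e.
case: e => e e'; rewrite ltcE /= => /andP[/eqP -> e0].
near=> z; apply: (le_lt_trans (normc_le_ReIm _)); rewrite ltcR.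
have -> : complex.Re ((a +i* b : R[i]) - z) = a - complex.Re z by case: (z).
have -> : complex.Im ((a +i* b : R[i]) - z) = b - complex.Im z by case: (z).
rewrite [e]splitr ltrD//; near: z.
  by apply: Fa; rewrite divr_gt0.
by apply: Fb; rewrite divr_gt0.
Unshelve. all: by end_near. Qed.

End complex_complete.

(* A copy of R[i] seen as a normed space over itself: the library's instance of
   completeness on the regular module, for realType, shadows any other one. *)
Definition scalars (R : realType) : Type := R[i]^o.
HB.instance Definition _ (R : realType) :=
  NormedModule.copy (scalars R) R[i]^o.
HB.instance Definition _ (R : realType) :=
  Uniform_isComplete.Build (scalars R) (@complex_complete R).

(* The form is linear in its first argument and conjugate-linear in the
   second one. *)
Record hilbert (R : realType) := Hilbert {
  hspace :> completeNormedModType R[i] ;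
  hdot : {dot hspace for Num.conj} ;
  hdotE : forall x : hspace, hdot x x = `|x| ^+ 2 }.

Section scalars_hilbert.
Context {R : realType}.
Local Notation C := (scalars R).

Definition scalars_dot (x y : C) : R[i] := (x : R[i]) * Num.conj (y : R[i]).

Fact scalars_dot_bilinear :
  bilinear_for ( *%R : R[i] -> R[i] -> R[i]) (Num.conj \; *%R) scalars_dot.
Proof.
split => z a x y; rewrite /scalars_dot /=.
  by rewrite mulrDl mulrA.
by rewrite rmorphD rmorphM mulrDr mulrCA.
Qed.
HB.instance Definition _ := bilinear_isBilinear.Build R[i] C C R[i] _ _ scalars_dot
  scalars_dot_bilinear.

Fact scalars_dot_hermitian x y :
  scalars_dot x y = (-1) ^+ false * Num.conj (scalars_dot y x).
Proof. by rewrite expr0 mul1r /scalars_dot rmorphM mulrC /= (@conjCK R[i]). Qed.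
HB.instance Definition _ :=
  isHermitianSesquilinear.Build R[i] C false Num.conj scalars_dot
    scalars_dot_hermitian.

Fact scalars_dot_gt0 (x : C) : x != 0 -> 0 < scalars_dot x x.
Proof. by move=> x0; rewrite /scalars_dot mul_conjC_gt0. Qed.
HB.instance Definition _ :=
  isDotProduct.Build R[i] C scalars_dot scalars_dot_gt0.

Fact scalars_dotE (x : C) : scalars_dot x x = `|x| ^+ 2.
Proof. by rewrite /scalars_dot -normCK. Qed.

Definition scalars_hilbert : hilbert R := Hilbert scalars_dotE.

End scalars_hilbert.
Arguments scalars_hilbert : clear implicits.

Section multiplier_spaces.
Context {R : realType}.
Local Notation C := (scalars_hilbert R).

Definition opnorm (H K : hilbert R) (f : {linear H -> K}) : \bar R :=
  ereal_sup [set (rnorm (f x))%:E | x in [set x : H | rnorm x <= 1]].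

(* A bounded function from nat to the bounded operators from H to K. *)
Record bounded_ops (H K : hilbert R) := BoundedOps {
  ops :> nat -> {linear H -> K} ;
  ops_bounded : exists M : R, forall t x, rnorm (ops t x) <= M * rnorm x }.

Definition supnorm (H K : hilbert R) (xi : bounded_ops H K) : \bar R :=
  ereal_sup (range (fun t => opnorm (xi t))).

(* [factors n K] is the type of sequences (xi_1, ..., xi_{n+1}) with xi_i a
   bounded function into B(H_i, H_{i-1}), H_0 = K and H_{n+1} = C; the spaces
   H_1, ..., H_n are part of the data. *)
Fixpoint factors (n : nat) (K : hilbert R) : Type :=
  if n is n'.+1 then {H : hilbert R & (bounded_ops H K * factors n' H)%type}
  else bounded_ops C K.

(* xi_1(t 0) xi_2(t 1) ... xi_{n+1}(t n), an operator from C to K *)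
Fixpoint factors_prod (n : nat) (K : hilbert R) (t : nat -> nat) :
    factors n K -> C -> K :=
  match n return factors n K -> C -> K with
  | 0 => fun xi => xi (t 0)
  | n'.+1 => fun xi v =>
      (projT2 xi).1 (t 0) (factors_prod (fun i => t i.+1) (projT2 xi).2 v)
  end.

Fixpoint factors_norm (n : nat) (K : hilbert R) : factors n K -> \bar R :=
  match n return factors n K -> \bar R with
  | 0 => fun xi => supnorm xi
  | n'.+1 => fun xi =>
      (supnorm (projT2 xi).1 * factors_norm (projT2 xi).2)%E
  end.

(* B(C, C) is identified with C through the value at 1. *)
Definition represents (n : nat) (xi : factors n C) (phi : nat -> R[i]) :=
  forall t : nat -> nat,
    phi (\sum_(i < n.+1) t i)%N = factors_prod t xi (1 : R[i]).

(* The values sup|xi_1| ... sup|xi_d| over all representations of phi; the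
   case d = 0 is meaningless. *)
Definition M_values (d : nat) (phi : nat -> R[i]) : set (\bar R) :=
  if d is n.+1 then
    [set c | exists2 xi : factors n C, represents xi phi & c = factors_norm xi]
  else set0.

Definition M_space (d : nat) : set (nat -> R[i]) :=
  [set phi | M_values d phi !=set0].

Definition M_norm (d : nat) (phi : nat -> R[i]) : \bar R :=
  ereal_inf (M_values d phi).

End multiplier_spaces.

Definition circle (R : realType) : Type :=
  set_type [set z : R[i]^o | `|z| = 1].
HB.instance Definition _ (R : realType) := Topological.on (circle R).

Definition circle_val (R : realType) (z : circle R) : R[i] := set_val z.

Section circle.
Context {R : realType}.

Definition expi (u : R) : R[i]^o := cos u +i* sin u.

Fact norm_expi u : [set z : R[i]^o | `|z| = 1] (expi u).
Proof. by rewrite /= normc_def /= cos2Dsin2 sqrtr1. Qed.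

Definition circle_expi (u : measurableTypeR R) : circle R :=
  SigSub (mem_set (norm_expi u)).

HB.instance Definition _ := isPointed.Build (circle R) (circle_expi 0).

(* The Borel sigma-algebra of the circle *)
HB.instance Definition _ := Measurable.copy (circle R)
  (g_sigma_algebraType (@open (circle R))).

Lemma continuous_expi : continuous expi.
Proof.
move=> u; apply/cvgrPdist_lt => e; case: e => e e'.
rewrite ltcE /= => /andP[/eqP -> e0].
have e20 : 0 < e / 2 by rewrite divr_gt0.
have /cvgrPdist_lt/(_ _ e20) cu := @continuous_cos R u.
have /cvgrPdist_lt/(_ _ e20) su := @continuous_sin R u.
near=> v; apply: (le_lt_trans (normc_le_ReIm _)).
by rewrite ltcR /= [e]splitr ltrD//; near: v.
Unshelve. all: by end_near. Qed.

Lemma measurable_circle_expi : measurable_fun [set: R] circle_expi.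
Proof.
apply: measurability => //= _ [U Uo <-]; rewrite setTI.
apply: open_measurable.
have : continuous circle_expi.
  by apply/continuous_comp_initial; exact: continuous_expi.
by move/continuousP; exact.
Qed.

Fact twopi_gt0 : 0 < 2 * pi :> R.
Proof. by rewrite mulr_gt0// pi_gt0. Qed.

HB.instance Definition _ := isMeasurableFun.Build _ _ (measurableTypeR R)
  (circle R) circle_expi measurable_circle_expi.

(* Normalized Lebesgue measure: the image under u |-> e^{iu} of the uniform
   probability on [0, 2 pi] *)
Definition circle_measure : probability (circle R) R :=
  distribution (uniform_prob twopi_gt0) circle_expi.

End circle.

Section hardy.
Context {R : realType}.
Local Notation T := (circle R).
Local Notation m := (@circle_measure R).

Definition norm_L1 (x : T -> R[i]) : \bar R := (\int[m]_z (rnorm (x z))%:E)%E.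

Definition L1 : set (T -> R[i]) := [set x |
  [/\ measurable_fun [set: T] (fun z => complex.Re (x z)),
      measurable_fun [set: T] (fun z => complex.Im (x z)) &
      (norm_L1 x < +oo)%E]].

Definition fourier (x : T -> R[i]) (n : int) : R[i] :=
  (\int[m]_z complex.Re (x z * circle_val z ^ (- n))) +i*
  (\int[m]_z complex.Im (x z * circle_val z ^ (- n))).

Definition H1 : set (T -> R[i]) :=
  [set x | L1 x /\ forall n : int, n < 0 -> fourier x n = 0].

Definition ball_H1 : set (T -> R[i]) := [set x | H1 x /\ (norm_L1 x <= 1)%E].

(* y is (a representative of) the element of H^1 with formal Fourier series
   sum_n a_n z^n *)
Definition has_series (a : nat -> R[i]) (y : T -> R[i]) : Prop :=
  H1 y /\ forall n : nat, fourier y n%:Z = a n.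

(* y is M_phi(x) *)
Definition multiplied (phi : nat -> R[i]) (x y : T -> R[i]) : Prop :=
  has_series (fun n => fourier x n%:Z * phi n) y.

(* y k is the function sum_n x^(n) z^n phi(n + k) *)
Definition shifted_series (phi : nat -> R[i]) (x : T -> R[i])
    (y : nat -> T -> R[i]) : Prop :=
  forall k, has_series (fun n => fourier x n%:Z * phi (n + k)%N) (y k).

Definition integral_sup (y : nat -> T -> R[i]) : \bar R :=
  (\int[m]_z ereal_sup (range (fun k => (rnorm (y k z))%:E)))%E.

(* Elements of L_1 are represented by functions defined everywhere: the
   functions M_phi(z^k x) are only determined almost everywhere, hence the
   quantification over all choices (y k)_k of them. The value of
   [integral_sup y] does not depend on the choice. *)
Definition shift_bounded (phi : nat -> R[i]) : Prop :=
  forall x, H1 x ->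
    let shift k := fun z : T => circle_val z ^+ k * x z in
    (forall k, exists y, multiplied phi (shift k) y) /\
    (forall y : nat -> T -> R[i],
       (forall k, multiplied phi (shift k) (y k)) -> (integral_sup y < +oo)%E).

End hardy.

(* Main.v *)
Require Import Defs.
From mathcomp Require Import all_boot all_order all_algebra.
From mathcomp Require Import sesquilinear.
From mathcomp Require Import all_classical all_reals all_analysis.
From mathcomp Require Import measurable_realfun.
From mathcomp Require Import complex.
From mathcomp Require Import finmap.
From mathcomp Require Import ring lra.

Set Implicit Arguments.
Unset Strict Implicit.
Unset Printing Implicit Defensive.

Import Order.TTheory GRing.Theory Num.Theory.
Import numFieldNormedType.Exports.

Local Open Scope classical_set_scope.
Local Open Scope complex_scope.
Local Open Scope ring_scope.

(** For a product [h * g] of two polynomials, a representation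
    [phi (i + k + j) = xi1 i (xi2 k (xi3 j 1))] turns the multiplied series into
    [\sum_n (h * g)_n z ^ n phi (n + k) = A(z) (xi2 k (B(z)))] with
    [A(z) = \sum_i h_i z ^ i xi1 i] and [B(z) = \sum_j g_j z ^ j xi3 j 1]: giving the
    middle argument to the shift [k] leaves [A] and [B] independent of [k]. Hence
    the supremum over [k] is at most [|A(z)| sup |xi2| |B(z)|], and by Parseval
    and the arithmetic-geometric mean inequality its integral is at most
    [sup |xi1| sup |xi2| sup |xi3|] times the mean of the squared L^2 norms of [h]
    and [g] ([max_shift_product]).

    Every [x] in H^1 is such a product with both squared norms equal to [|x|_1], but
    only polynomials and approximate factorizations are needed. A polynomial is,
    up to an error small in the sum of the absolute values of the coefficients,
    a product [h * g] with [|h| ^ 2] and [|g| ^ 2] at most [|p| + eps] on the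
    circle ([poly_factorable]). This property is multiplicative, so that it is
    enough to consider the factors of degree one. A root outside of the open disc
    gives [1 - c X] with [|c| <= 1], which has polynomial approximate square roots
    ([sqrt_approx]); a root [a] inside is treated by the Blaschke factor
    [(z - a) / (1 - conj a z)], truncated.

    General elements of H^1 are reached by their Cesaro means, which are
    contractions of L^1 and converge in L^1 ([fejer_cvg_L1]; Lipschitz functions
    are dense by [lip_approx_integrable]), and which commute with multipliers
    ([multp_fejer_poly]). The bound for the maximum over finitely many shifts
    passes to the limit ([integral_running_max_le]), and monotone convergence
    gives the supremum. The existence of [M_phi x] follows from the estimate
    on polynomials and the completeness of L^1 ([multiplier_exists]).

    Finally, [|M_phi (z ^ k x)|] is the modulus of [\sum_n x^(n) z ^ n phi (n + k)],
    the two functions differing by the factor [z ^ k] ([unshift_series]). *)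

(** * The real-valued norm *)

Section rnorm_theory.
Context {R : realType}.
Implicit Types (V : normedZmodType R[i]) (a b : R[i]).

Lemma rnorm_ge0 V (x : V) : 0 <= rnorm x.
Proof. by rewrite -lecR rnormE; exact: normr_ge0. Qed.

Lemma rnormD V (x y : V) : rnorm (x + y) <= rnorm x + rnorm y.
Proof. by rewrite -lecR rmorphD/= !rnormE ler_normD. Qed.

Lemma rnorm0 V : rnorm (0 : V) = 0.
Proof. by rewrite /rnorm normr0. Qed.

Lemma rnormN V (x : V) : rnorm (- x) = rnorm x.
Proof. by rewrite /rnorm normrN. Qed.

Lemma rnormB V (x y : V) : rnorm (x - y) = rnorm (y - x).
Proof. by rewrite -rnormN opprB. Qed.

Lemma rnorm_sum V I (r : seq I) (P : pred I) (F : I -> V) :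
  rnorm (\sum_(i <- r | P i) F i) <= \sum_(i <- r | P i) rnorm (F i).
Proof.
elim/big_ind2 : _ => [|x1 x2 y1 y2 h1 h2|//]; first by rewrite rnorm0.
by rewrite (le_trans (rnormD _ _))// lerD.
Qed.

Lemma rnormM a b : rnorm (a * b) = rnorm a * rnorm b.
Proof. by apply: complexI; rewrite rmorphM/= !rnormE normrM. Qed.

Lemma rnorm1 : rnorm (1 : R[i]) = 1.
Proof. by rewrite /rnorm normr1. Qed.

Lemma rnormX a n : rnorm (a ^+ n) = rnorm a ^+ n.
Proof. by elim: n => [|n IH]; rewrite ?expr0 ?rnorm1// !exprS rnormM IH. Qed.

Lemma rnormV a : rnorm a^-1 = (rnorm a)^-1.
Proof. by apply: complexI; rewrite fmorphV/= !rnormE normfV. Qed.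

Lemma rnorm_conj a : rnorm (Num.conj a) = rnorm a.
Proof. by rewrite /rnorm norm_conjC. Qed.

Lemma rnormR (r : R) : rnorm (r%:C) = `|r|.
Proof. by apply: complexI; rewrite rnormE normc_def/= expr0n/= addr0 sqrtr_sqr. Qed.

Lemma Re_le_rnorm a : complex.Re a <= rnorm a.
Proof. by rewrite (le_trans (ler_norm _))// -lecR rnormE normc_ge_Re. Qed.

Lemma normRe_le_rnorm a : `|complex.Re a| <= rnorm a.
Proof. by rewrite -lecR rnormE normc_ge_Re. Qed.

Lemma normIm_le_rnorm a : `|complex.Im a| <= rnorm a.
Proof. by rewrite -lecR rnormE normc_ge_Im. Qed.

Lemma rnorm_le_ReIm a : rnorm a <= `|complex.Re a| + `|complex.Im a|.
Proof. by rewrite -lecR rnormE normc_le_ReIm. Qed.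

Lemma rnorm_sqrt a : rnorm a = Num.sqrt (complex.Re a ^+ 2 + complex.Im a ^+ 2).
Proof. by apply: complexI; rewrite rnormE normc_def. Qed.

Lemma rnorm_mulC a : ((rnorm a) ^+ 2)%:C = a * Num.conj a.
Proof. by rewrite rmorphXn/= rnormE normCK. Qed.

Lemma rnorm_eq0 V (x : V) : rnorm x = 0 -> x = 0.
Proof. by move=> h; apply/normr0_eq0; rewrite -rnormE h. Qed.

End rnorm_theory.

(** * Polynomials and the sum of the absolute values of their coefficients *)

Section poly_l1.
Context {R : realType}.
Implicit Types (p q : {poly R[i]}) (P Q : {poly R}).

(** The sum of the absolute values of the coefficients. *)
Definition l1 p : R := \sum_(i < size p) rnorm p`_i.

(** [P] has nonnegative coefficients which dominate those of [p]. *)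
Definition majorizes P p := forall n, rnorm p`_n <= P`_n.

Lemma horner_majorant P p : majorizes P p -> l1 p <= P.[1].
Proof.
move=> h; rewrite (@horner_coef_wide _ (maxn (size p) (size P))) ?leq_maxr//.
have -> : l1 p = \sum_(i < maxn (size p) (size P)) rnorm p`_i.
  rewrite /l1 -!(big_mkord xpredT (fun i => rnorm p`_i)).
  rewrite [RHS](@big_cat_nat _ _ _ (size p))//= ?leq_maxl//.
  rewrite -[LHS]addr0; congr (_ + _).
  rewrite big_nat_cond big1// => i /andP[/andP[hi _] _].
  by rewrite nth_default// rnorm0.
by apply: ler_sum => i _; rewrite expr1n mulr1.
Qed.

(** The polynomial whose coefficients are the absolute values of those of [p]. *)
Definition abs_poly p : {poly R} := \poly_(i < size p) rnorm p`_i.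

Lemma abs_poly_majorizes p : majorizes (abs_poly p) p.
Proof.
move=> n; rewrite coef_poly; case: ltnP => // h.
by rewrite nth_default// rnorm0.
Qed.

Lemma horner_abs_poly p : (abs_poly p).[1] = l1 p.
Proof.
rewrite (horner_coef_wide _ (size_poly _ _)); apply: eq_bigr => i _.
by rewrite expr1n mulr1 coef_poly ltn_ord.
Qed.

Lemma majorizesM P Q p q :
  majorizes P p -> majorizes Q q -> majorizes (P * Q) (p * q).
Proof.
move=> hp hq n; rewrite !coefM (le_trans (rnorm_sum _ _ _))//.
apply: ler_sum => i _; rewrite rnormM ler_pM ?rnorm_ge0//.
Qed.

Lemma majorizesD P Q p q :
  majorizes P p -> majorizes Q q -> majorizes (P + Q) (p + q).
Proof.
by move=> hp hq n; rewrite !coefD (le_trans (rnormD _ _))// lerD.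
Qed.

Lemma l1_ge0 p : 0 <= l1 p.
Proof. by apply: sumr_ge0 => i _; exact: rnorm_ge0. Qed.

Lemma l1M p q : l1 (p * q) <= l1 p * l1 q.
Proof.
rewrite -!horner_abs_poly -hornerM horner_abs_poly.
by apply/horner_majorant/majorizesM; exact: abs_poly_majorizes.
Qed.

Lemma l1D p q : l1 (p + q) <= l1 p + l1 q.
Proof.
rewrite -!horner_abs_poly -hornerD horner_abs_poly.
by apply/horner_majorant/majorizesD; exact: abs_poly_majorizes.
Qed.

Lemma l1N p : l1 (- p) = l1 p.
Proof. by rewrite /l1 size_polyN; apply: eq_bigr => i _; rewrite coefN rnormN. Qed.

Lemma l1C (a : R[i]) : l1 a%:P = rnorm a.
Proof.
rewrite /l1 size_polyC; case: eqP => [->|_] /=; first by rewrite big_ord0 rnorm0.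
by rewrite big_ord_recl big_ord0 addr0 coefC.
Qed.

Lemma l1X : l1 'X = 1.
Proof. by rewrite /l1 size_polyX !big_ord_recl big_ord0 !coefX/= rnorm0 rnorm1 add0r addr0. Qed.

Lemma l1Xn p n : l1 (p ^+ n) <= l1 p ^+ n.
Proof.
elim: n => [|n IH]; first by rewrite !expr0 -polyC1 l1C rnorm1.
by rewrite !exprS (le_trans (l1M _ _))// ler_wpM2l// l1_ge0.
Qed.

Lemma rnorm_horner_le p (z : R[i]) : rnorm z <= 1 -> rnorm p.[z] <= l1 p.
Proof.
move=> z1; rewrite horner_coef (le_trans (rnorm_sum _ _ _))//.
apply: ler_sum => i _; rewrite rnormM rnormX ler_piMr ?rnorm_ge0//.
by rewrite exprn_ile1// rnorm_ge0.
Qed.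

(** Coefficientwise multiplication by a sequence. *)
Definition multp (f : nat -> R[i]) p : {poly R[i]} := \poly_(i < size p) (p`_i * f i).

Lemma coef_multp f p n : (multp f p)`_n = p`_n * f n.
Proof. by rewrite coef_poly; case: ltnP => // h; rewrite nth_default// mul0r. Qed.

Lemma multpD f p q : multp f (p + q) = multp f p + multp f q.
Proof. by apply/polyP => n; rewrite !(coefD, coef_multp) mulrDl. Qed.

Lemma multpB f p q : multp f (p - q) = multp f p - multp f q.
Proof. by apply/polyP => n; rewrite !(coefB, coef_multp) mulrBl. Qed.

Lemma l1_multp f p (M : R) : (forall n, rnorm (f n) <= M) -> l1 (multp f p) <= l1 p * M.
Proof.
move=> hM; have -> : l1 p * M = (M *: abs_poly p).[1].
  by rewrite hornerZ horner_abs_poly mulrC.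
apply: horner_majorant => n; rewrite coef_multp coefZ rnormM mulrC.
rewrite ler_pM ?rnorm_ge0//; exact: abs_poly_majorizes.
Qed.

End poly_l1.

(** * Approximate factorization of polynomials *)

Section factorization.
Context {R : realType}.
Implicit Types (p q : {poly R[i]}) (a c z : R[i]).

(** Up to an arbitrarily small error, [p] is a product of two polynomials whose
    squared absolute values do not exceed that of [p] on the unit circle. *)
Definition factorable p := forall eps : R, 0 < eps -> exists h g : {poly R[i]},
  l1 (p - h * g) <= eps /\
  forall z, rnorm z = 1 -> rnorm h.[z] ^+ 2 <= rnorm p.[z] + eps /\
                           rnorm g.[z] ^+ 2 <= rnorm p.[z] + eps.

Lemma factorableM p q : factorable p -> factorable q -> factorable (p * q).
Proof.
move=> fp fq eps eps0; set A := l1 p; set B := l1 q.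
have A0 : 0 <= A := l1_ge0 p.
have B0 : 0 <= B := l1_ge0 q.
pose e := Num.min 1 (eps / (A + B + 1)).
have AB0 : 0 < A + B + 1 by lra.
have e0 : 0 < e by rewrite lt_min ltr01 divr_gt0.
have e1 : e <= 1 by rewrite ge_min lexx.
have eE : e * (A + B + 1) <= eps by rewrite -ler_pdivlMr// ge_min lexx orbT.
have [h1 [g1 [l1e hg1]]] := fp _ e0.
have [h2 [g2 [l2e hg2]]] := fq _ e0.
exists (h1 * h2), (g1 * g2); split.
  have -> : p * q - h1 * h2 * (g1 * g2) =
      (p - h1 * g1) * q + h1 * g1 * (q - h2 * g2) by ring.
  have hg : l1 (h1 * g1) <= A + e.
    have -> : h1 * g1 = p + - (p - h1 * g1) by ring.
    by rewrite (le_trans (l1D _ _))// l1N lerD2l.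
  rewrite (le_trans (l1D _ _))// (le_trans _ eE)//.
  have := l1M (p - h1 * g1) q; have := l1M (h1 * g1) (q - h2 * g2).
  have := l1_ge0 (q - h2 * g2); have := l1_ge0 (h1 * g1).
  move: hg l1e l2e; rewrite -/A -/B; set u := l1 (h1 * g1).
  set v := l1 (q - _); set w := l1 (p - _) => hu hw hv u0 v0 h1' h2'.
  have : u * v <= (A + e) * e by rewrite ler_pM.
  have : w * B <= e * B by rewrite ler_wpM2r.
  have : e * e <= e by rewrite ler_piMr// ltW.
  move: h1' h2'; lra.
move=> z z1; have [hz1 gz1] := hg1 _ z1; have [hz2 gz2] := hg2 _ z1.
have pz : rnorm p.[z] <= A by rewrite rnorm_horner_le// z1.
have qz : rnorm q.[z] <= B by rewrite rnorm_horner_le// z1.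
have p0 := rnorm_ge0 p.[z]; have q0 := rnorm_ge0 q.[z].
have key : (rnorm p.[z] + e) * (rnorm q.[z] + e) <= rnorm (p * q).[z] + eps.
  rewrite hornerM rnormM; have ee : e * e <= e by rewrite ler_piMr// ltW.
  have pe : rnorm p.[z] * e <= A * e by rewrite ler_wpM2r// ltW.
  have qe : rnorm q.[z] * e <= B * e by rewrite ler_wpM2r// ltW.
  move: ee pe qe eE; rewrite -/A; lra.
by split; rewrite hornerM rnormM exprMn (le_trans _ key)// ler_pM// sqr_ge0.
Qed.

Lemma factorableC c : factorable c%:P.
Proof.
move=> eps eps0; exists (sqrtC c)%:P, (sqrtC c)%:P.
rewrite -polyCM -expr2 sqrtCK subrr -polyC0 l1C rnorm0; split; first exact: ltW.
move=> z _; rewrite !hornerC -rnormX sqrtCK; split; lra.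
Qed.

(** Successive approximations of the square root of [1 - c X]: writing it as
    [1 - T], one has [T = (c X + T ^ 2) / 2]. *)
Fixpoint sqrt_iter (K : numFieldType) (c : K) (k : nat) : {poly K} :=
  if k is k'.+1 then 2^-1 *: (c *: 'X + sqrt_iter c k' ^+ 2) else 0.

Lemma sqrt_iter_step (K : numFieldType) (c : K) k :
  sqrt_iter c k.+2 - sqrt_iter c k.+1 =
  2^-1 *: ((sqrt_iter c k.+1 - sqrt_iter c k) *
           (sqrt_iter c k.+1 + sqrt_iter c k)).
Proof.
transitivity (2^-1 *: (c *: 'X + sqrt_iter c k.+1 ^+ 2) -
              2^-1 *: (c *: 'X + sqrt_iter c k ^+ 2)); first by [].
by rewrite -scalerBr -subr_sqr; congr (_ *: _); rewrite opprD addrACA subrr add0r.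
Qed.

Lemma majorizesZ P p (r : R) : 0 <= r -> majorizes P p ->
  majorizes (r *: P) (r%:C *: p).
Proof.
move=> r0 h n; rewrite !coefZ rnormM rnormR ger0_norm//.
by rewrite ler_wpM2l.
Qed.

Lemma sqrt_iter_majorizes c k : rnorm c <= 1 ->
  majorizes (sqrt_iter (1 : R) k) (sqrt_iter c k) /\
  majorizes (sqrt_iter (1 : R) k.+1 - sqrt_iter 1 k)
            (sqrt_iter c k.+1 - sqrt_iter c k).
Proof.
move=> c1; have half : (2^-1 : R[i]) = (2^-1 : R)%:C.
  by rewrite fmorphV rmorph_nat.
elim: k => [|k [IH1 IH2]].
  split; first by move=> n /=; rewrite !coef0 rnorm0.
  rewrite /= !subr0 !expr0n/= !addr0 half; apply: majorizesZ; first by lra.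
  move=> n; rewrite !coefZ !coefX rnormM mul1r; case: (n == 1)%N => /=.
    by rewrite rnorm1 mulr1.
  by rewrite rnorm0 mulr0.
have IH : majorizes (sqrt_iter (1 : R) k.+1) (sqrt_iter c k.+1).
  have -> : sqrt_iter (1 : R) k.+1 =
    (sqrt_iter 1 k.+1 - sqrt_iter 1 k) + sqrt_iter 1 k by rewrite subrK.
  have -> : sqrt_iter c k.+1 =
    (sqrt_iter c k.+1 - sqrt_iter c k) + sqrt_iter c k by rewrite subrK.
  exact: majorizesD.
split => //; rewrite !sqrt_iter_step half; apply: majorizesZ; first by lra.
by apply: majorizesM => //; exact: majorizesD.
Qed.

Lemma sqrt_iter_bound k : 0 <= (sqrt_iter (1 : R) k).[1] <= 1.
Proof.
elim: k => [|k /andP[h0 h1]] /=; first by rewrite horner0; lra.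
rewrite hornerZ hornerD hornerZ hornerX horner_exp.
by set t := _.[1] in h0 h1 *; nra.
Qed.

Lemma sqrt_approx c (eps : R) : rnorm c <= 1 -> 0 < eps ->
  exists s : {poly R[i]}, l1 (s ^+ 2 - (1 - c *: 'X)) <= eps.
Proof.
move=> c1 eps0; pose t k := (sqrt_iter (1 : R) k).[1].
(* t is bounded by 1, so that its increments cannot all exceed eps / 2 *)
have [k hk] : exists k, 2 * (t k.+1 - t k) <= eps.
  apply: contrapT => /forallNP h.
  have tk k : eps / 2 * k%:R <= t k.
    elim: k => [|k IH]; first by rewrite mulr0 /t /= horner0.
    have /negP := h k; rewrite -ltNge => hk; rewrite -(natr1 k); lra.
  have /archi_boundP : 0 <= 2 / eps by rewrite divr_ge0// ltW.
  set n := Num.bound _; rewrite ltr_pdivrMr// => hn.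
  by have := tk n; have /andP[_] := sqrt_iter_bound n; rewrite -/(t n); nra.
exists (1 - sqrt_iter c k); apply: le_trans hk.
have -> : (1 - sqrt_iter c k) ^+ 2 - (1 - c *: 'X) =
    (2 : R)%:C *: (sqrt_iter c k.+1 - sqrt_iter c k).
  rewrite /= scalerBr scalerA rmorph_nat mulfV ?pnatr_eq0// scale1r.
  rewrite scaler_nat; ring.
have -> : 2 * (t k.+1 - t k) =
    (2 *: (sqrt_iter (1 : R) k.+1 - sqrt_iter 1 k)).[1].
  by rewrite hornerZ hornerD hornerN.
apply: horner_majorant; apply: majorizesZ; first by lra.
by have [] := sqrt_iter_majorizes k c1.
Qed.

Lemma rnorm_horner_dist p q z (e : R) : rnorm z = 1 -> l1 (p - q) <= e ->
  rnorm p.[z] <= rnorm q.[z] + e.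
Proof.
move=> z1 h; rewrite -[p](subrK q) hornerD addrC (le_trans (rnormD _ _))//.
by rewrite lerD2l (le_trans _ h)// rnorm_horner_le// z1.
Qed.

(** A root outside of the open unit disc: both factors are a square root. *)
Lemma factorable_1subcX c : rnorm c <= 1 -> factorable (1 - c *: 'X).
Proof.
move=> c1 eps eps0; have [s hs] := sqrt_approx c1 eps0.
exists s, s; split; first by rewrite -expr2 -l1N opprB.
by move=> z z1; rewrite -rnormX -horner_exp; split; exact: rnorm_horner_dist.
Qed.

Lemma rnorm_blaschke a z : rnorm z = 1 ->
  rnorm (1 - Num.conj a * z) = rnorm (z - a).
Proof.
move=> z1; have zz : z * Num.conj z = 1 by rewrite -rnorm_mulC z1 expr1n.
have -> : 1 - Num.conj a * z = z * Num.conj (z - a).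
  by rewrite rmorphB/= mulrBr zz mulrC.
by rewrite rnormM z1 mul1r rnorm_conj.
Qed.

(** A root inside of the unit disc: with [c] the conjugate of [a], the factors
    approximate [(1 - c X) ^ (1 / 2)] and the Blaschke factor
    [(X - a) / (1 - c X)] times it. *)
Lemma factorable_inner a : rnorm a < 1 -> factorable ('X - a%:P).
Proof.
move=> a1 eps eps0; pose c := Num.conj a.
have c1 : rnorm c < 1 by rewrite rnorm_conj.
have [N hN] : exists N, 12 * rnorm a ^+ N <= eps.
  have e12 : 0 < eps / 12 by rewrite divr_gt0.
  have ra : `|rnorm a| < 1 by rewrite ger0_norm ?rnorm_ge0.
  have /cvgrPdist_le /(_ _ e12) [N _ /(_ N (leqnn N))] := cvg_expr ra.
  rewrite /= sub0r normrN ger0_norm ?exprn_ge0 ?rnorm_ge0// => h.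
  by exists N; lra.
set n := rnorm a ^+ N in hN.
have n0 : 0 <= n by rewrite exprn_ge0 ?rnorm_ge0.
have n1 : n <= 1 by rewrite exprn_ile1 ?rnorm_ge0// ltW.
(* the truncated geometric series of 1 / (1 - c X) *)
pose D : {poly R[i]} := \sum_(i < N) (c *: 'X) ^+ i.
pose d := l1 D.
have d0 : 0 <= d := l1_ge0 D.
have DE : (1 - c *: 'X) * D = 1 - (c *: 'X) ^+ N.
  by rewrite -[in RHS](expr1n _ N) subrXX; congr (_ * _); apply: eq_bigr => i _;
     rewrite expr1n mul1r.
pose e := eps / (8 * (d + 1) ^+ 2).
have de0 : 0 < 8 * (d + 1) ^+ 2 by rewrite mulr_gt0// exprn_gt0//; lra.
have e0 : 0 < e by rewrite divr_gt0.
have eE : 8 * (d + 1) ^+ 2 * e = eps by rewrite mulrC divfK// gt_eqF.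
have [s hs] := sqrt_approx (ltW c1) e0.
have nX : l1 ((c *: 'X) ^+ N) <= n.
  rewrite (le_trans (l1Xn _ _))// lerXn2r ?nnegrE ?l1_ge0 ?rnorm_ge0//.
  by rewrite -mul_polyC (le_trans (l1M _ _))// l1C l1X mulr1 rnorm_conj.
exists s, (('X - a%:P) * D * s); split.
  have -> : 'X - a%:P - s * (('X - a%:P) * D * s) =
      ('X - a%:P) * ((c *: 'X) ^+ N - D * (s ^+ 2 - (1 - c *: 'X))).
    have -> : (c *: 'X) ^+ N = 1 - (1 - c *: 'X) * D by rewrite DE; ring.
    ring.
  rewrite (le_trans (l1M _ _))//.
  have := l1D ((c *: 'X) ^+ N) (- (D * (s ^+ 2 - (1 - c *: 'X)))).
  rewrite l1N; have := l1M D (s ^+ 2 - (1 - c *: 'X)).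
  have : l1 ('X - a%:P) <= 2.
    rewrite (le_trans (l1D _ _))// l1N l1C l1X; lra.
  have := l1_ge0 ('X - a%:P); have := l1_ge0 (s ^+ 2 - (1 - c *: 'X)).
  have := l1_ge0 ((c *: 'X) ^+ N - D * (s ^+ 2 - (1 - c *: 'X))).
  rewrite -/d; move: hs nX; set x1 := l1 (s ^+ 2 - _); set x2 := l1 ('X - _).
  set x3 := l1 (_ ^+ N); set x4 := l1 (D * _); set x5 := l1 (_ - D * _).
  move=> h1 h2 p5 p1 p2 h3 h4 h5.
  have : d * x1 <= d * e by rewrite ler_wpM2l.
  have : x2 * x5 <= 2 * x5 by rewrite ler_wpM2r.
  nra.
move=> z z1; rewrite hornerD hornerN hornerC hornerX.
have cz : rnorm (1 - c *: 'X).[z] = rnorm (z - a).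
  by rewrite hornerD hornerN hornerZ hornerX hornerC rnorm_blaschke.
have := rnorm_horner_dist z1 hs; rewrite cz horner_exp rnormX => sz.
have ee : e <= eps by nra.
split; first by rewrite (le_trans sz)// lerD2l.
rewrite !hornerM hornerD hornerN hornerC hornerX !rnormM !exprMn.
have Dz : rnorm D.[z] <= d by rewrite rnorm_horner_le// z1.
have DN : rnorm (z - a) * rnorm D.[z] <= 1 + n.
  rewrite -cz -rnormM -hornerM DE (le_trans (rnorm_horner_le _ _)) ?z1//.
  rewrite (le_trans (l1D _ _))// -polyC1 l1C rnorm1 lerD2l l1N//.
have za2 : rnorm (z - a) <= 2 by rewrite (le_trans (rnormD _ _))// rnormN z1; lra.
move: cz sz Dz DN za2 (rnorm_ge0 (z - a)) (rnorm_ge0 D.[z]) => _.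
set x := rnorm (z - a); set y := rnorm D.[z]; set w := rnorm s.[z] ^+ 2.
move=> sz Dz DN za2 x0 y0.
have xy2 : (x * y) ^+ 2 <= (1 + n) ^+ 2.
  by rewrite lerXn2r ?nnegrE ?mulr_ge0//; lra.
have h1 : x ^+ 2 * y ^+ 2 * w <= (x * y) ^+ 2 * (x + e).
  by rewrite -exprMn ler_wpM2l// sqr_ge0.
have h2 : (x * y) ^+ 2 * x <= (1 + n) ^+ 2 * x by rewrite ler_wpM2r.
have h3 : (x * y) ^+ 2 <= (2 * d) ^+ 2.
  by rewrite lerXn2r ?nnegrE ?mulr_ge0// ler_pM.
have h4 : (x * y) ^+ 2 * e <= (2 * d) ^+ 2 * e by rewrite ler_wpM2r// ltW.
have h5 : (2 * d) ^+ 2 * e <= eps / 2 by nra.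
have h6 : (1 + n) ^+ 2 * x <= x + 6 * n.
  have : n * n <= n by rewrite ler_piMr.
  nra.
rewrite (le_trans h1)// mulrDr; lra.
Qed.

Lemma factorable_XsubC a : factorable ('X - a%:P).
Proof.
have [a1|a1] := ltP (rnorm a) 1; first exact: factorable_inner.
have a0 : a != 0 by apply/eqP => a0; move: a1; rewrite a0 rnorm0; lra.
have -> : 'X - a%:P = (- a)%:P * (1 - a^-1 *: 'X).
  by rewrite mulrBr mulr1 mul_polyC scalerA mulNr mulfV// scaleN1r opprK polyCN addrC.
apply: factorableM; first exact: factorableC.
by apply: factorable_1subcX; rewrite rnormV invf_le1// (lt_le_trans ltr01).
Qed.

Lemma poly_factorable p : factorable p.
Proof.
have [r ->] := closed_field_poly_normal p.
rewrite -mul_polyC; apply: factorableM; first exact: factorableC.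
elim: r => [|a r IH]; first by rewrite big_nil -polyC1; exact: factorableC.
by rewrite big_cons; apply: factorableM => //; exact: factorable_XsubC.
Qed.

End factorization.

(** * Measurable functions on the circle *)

Section circle_measurability.
Context {R : realType}.
Local Notation T := (circle R).
Local Notation m := (@circle_measure R).
Implicit Types (f g : T -> R[i]) (z w : T).

Lemma rnorm_circle z : rnorm (circle_val z) = 1.
Proof. by apply: complexI; rewrite rnormE; exact: (set_valP z). Qed.

Lemma circle_val_neq0 z : circle_val z != 0.
Proof.
apply/eqP => h; have := rnorm_circle z; rewrite h rnorm0 => /eqP.
by rewrite eq_sym oner_eq0.
Qed.

Lemma circle_val_inv z : (circle_val z)^-1 = Num.conj (circle_val z).
Proof.
apply: (mulfI (circle_val_neq0 z)).
by rewrite mulfV ?circle_val_neq0// -rnorm_mulC rnorm_circle expr1n.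
Qed.

Lemma rnorm_circleXz z (n : int) : rnorm (circle_val z ^ n) = 1.
Proof.
by case: n => n; rewrite /exprz ?rnormV rnormX rnorm_circle expr1n ?invr1.
Qed.

Lemma lipschitz_measurable (g : T -> R) (L : R) :
  (forall z w, `|g z - g w| <= L * rnorm (circle_val z - circle_val w)) ->
  measurable_fun [set: T] g.
Proof.
move=> hL; apply: (measurability _ (RGenOInfty.measurableE R)) => //=.
move=> _ [_ [x ->] <-]; rewrite setTI; apply: sub_sigma_algebra.
rewrite openE => z /=; rewrite in_itv/= andbT => xz.
pose e := (g z - x) / (`|L| + 1).
have L0 : 0 < `|L| + 1 by rewrite ltr_wpDl.
have e0 : 0 < e by rewrite divr_gt0// subr_gt0.
have ec : 0 < e%:C :> R[i] by rewrite ltcR.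
have := @initial_continuous _ _ (@set_val _ [set z : R[i]^o | `|z| = 1]) z.
move=> /cvgrPdist_lt /(_ _ ec); apply: filterS => w /= hw.
rewrite in_itv/= andbT.
have {}hw : rnorm (circle_val z - circle_val w) < e by rewrite -ltcR rnormE.
have : `|g z - g w| < g z - x.
  apply: (le_lt_trans (hL z w)).
  have -> : g z - x = (`|L| + 1) * e by rewrite mulrC divfK// gt_eqF.
  have [->|L1] := eqVneq (rnorm (circle_val z - circle_val w)) 0.
    by rewrite mulr0 mulr_gt0.
  apply: (@le_lt_trans _ _ ((`|L| + 1) * rnorm (circle_val z - circle_val w))).
    by rewrite ler_wpM2r ?rnorm_ge0// (le_trans (ler_norm _))// lerDl.
  by rewrite ltr_pM2l.
by rewrite ltr_norml => /andP[_]; rewrite ltrBrDl; lra.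
Qed.

(** Measurability of a complex function. *)
Definition cmeas f := measurable_fun [set: T] (fun z => complex.Re (f z)) /\
                      measurable_fun [set: T] (fun z => complex.Im (f z)).

Lemma cmeasD f g : cmeas f -> cmeas g -> cmeas (fun z => f z + g z).
Proof.
move=> [f1 f2] [g1 g2]; split.
  by apply: eq_measurable_fun (measurable_funD f1 g1) => z _ /=; case: (f z); case: (g z).
by apply: eq_measurable_fun (measurable_funD f2 g2) => z _ /=; case: (f z); case: (g z).
Qed.

Lemma cmeasN f : cmeas f -> cmeas (fun z => - f z).
Proof.
move=> [f1 f2]; split.
  apply: eq_measurable_fun (measurableT_comp (@oppr_measurable R setT) f1).
  by move=> z _ /=; case: (f z).
apply: eq_measurable_fun (measurableT_comp (@oppr_measurable R setT) f2).
by move=> z _ /=; case: (f z).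
Qed.

Lemma cmeasB f g : cmeas f -> cmeas g -> cmeas (fun z => f z - g z).
Proof. by move=> mf mg; apply: cmeasD => //; exact: cmeasN. Qed.

Lemma cmeasM f g : cmeas f -> cmeas g -> cmeas (fun z => f z * g z).
Proof.
move=> [f1 f2] [g1 g2]; split.
  apply: eq_measurable_fun (measurable_funB (measurable_funM f1 g1)
    (measurable_funM f2 g2)) => z _ /=.
  by case: (f z); case: (g z).
apply: eq_measurable_fun (measurable_funD (measurable_funM f1 g2)
    (measurable_funM f2 g1)) => z _ /=.
by case: (f z); case: (g z).
Qed.

Lemma cmeas_cst (a : R[i]) : cmeas (fun=> a).
Proof. by split; exact: measurable_cst. Qed.

Lemma cmeasC (g : T -> R) : measurable_fun [set: T] g -> cmeas (fun z => (g z)%:C).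
Proof. by move=> mg; split => //=; exact: measurable_cst. Qed.

Lemma cmeasX f n : cmeas f -> cmeas (fun z => f z ^+ n).
Proof.
move=> mf; elim: n => [|n IH].
  rewrite (_ : (fun z => _) = fun=> 1); first exact: cmeas_cst.
  by apply/funext => z; rewrite expr0.
rewrite (_ : (fun z => _) = fun z => f z * f z ^+ n); first exact: cmeasM.
by apply/funext => z; rewrite exprS.
Qed.

Lemma cmeas_conj f : cmeas f -> cmeas (fun z => Num.conj (f z)).
Proof.
move=> [f1 f2]; split.
  by apply: eq_measurable_fun f1 => z _ /=; case: (f z).
apply: eq_measurable_fun (measurableT_comp (@oppr_measurable R setT) f2).
by move=> z _ /=; case: (f z).
Qed.

Lemma cmeas_sum I (r : seq I) (P : pred I) (F : I -> T -> R[i]) :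
  (forall i, cmeas (F i)) -> cmeas (fun z => \sum_(i <- r | P i) F i z).
Proof.
move=> mF; elim: r => [|i r IH].
  rewrite (_ : (fun z => _) = fun=> 0); first exact: cmeas_cst.
  by apply/funext => z; rewrite big_nil.
rewrite (_ : (fun z => _) =
  fun z => (if P i then F i z else 0) + \sum_(j <- r | P j) F j z).
  by apply: cmeasD => //; case: (P i) => //; exact: cmeas_cst.
by apply/funext => z; rewrite big_cons; case: (P i); rewrite ?add0r.
Qed.

Lemma cmeas_circle_val : cmeas (@circle_val R).
Proof.
split; apply: (@lipschitz_measurable _ 1) => z w; rewrite mul1r.
  have -> : complex.Re (circle_val z) - complex.Re (circle_val w) =
    complex.Re (circle_val z - circle_val w).
    by case: (circle_val z); case: (circle_val w).
  exact: normRe_le_rnorm.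
have -> : complex.Im (circle_val z) - complex.Im (circle_val w) =
    complex.Im (circle_val z - circle_val w).
  by case: (circle_val z); case: (circle_val w).
exact: normIm_le_rnorm.
Qed.

Lemma cmeas_circleXz (n : int) : cmeas (fun z => circle_val z ^ n).
Proof.
case: n => n; first exact/cmeasX/cmeas_circle_val.
rewrite (_ : (fun z => _) = fun z => Num.conj (circle_val z ^+ n.+1)).
  exact/cmeas_conj/cmeasX/cmeas_circle_val.
by apply/funext => z; rewrite /exprz -exprVn circle_val_inv rmorphXn.
Qed.

Lemma cmeas_horner (p : {poly R[i]}) : cmeas (fun z => p.[circle_val z]).
Proof.
rewrite (_ : (fun z => _) = fun z => \sum_(i < size p) p`_i * circle_val z ^+ i).
  apply: cmeas_sum => i; apply: cmeasM; first exact: cmeas_cst.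
  exact/cmeasX/cmeas_circle_val.
by apply/funext => z; rewrite horner_coef.
Qed.

Lemma measurable_rnorm f : cmeas f -> measurable_fun [set: T] (fun z => rnorm (f z)).
Proof.
move=> [f1 f2]; have h : measurable_fun [set: T]
    (fun z => complex.Re (f z) ^+ 2 + complex.Im (f z) ^+ 2).
  by apply: measurable_funD; exact: measurable_funX.
have ms : measurable_fun [set: R] (@Num.sqrt R).
  by apply: continuous_measurable_fun; exact: sqrt_continuous.
by apply: eq_measurable_fun (measurableT_comp ms h) => z _ /=; rewrite -rnorm_sqrt.
Qed.

Lemma measurable_rnormE f : cmeas f ->
  measurable_fun [set: T] (fun z => (rnorm (f z))%:E).
Proof. by move=> mf; apply/measurable_EFinP; exact: measurable_rnorm. Qed.

End circle_measurability.

(** * Integrable functions on the circle *)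

Section L1_theory.
Context {R : realType}.
Local Notation T := (circle R).
Local Notation m := (@circle_measure R).
Implicit Types (f g : T -> R[i]) (z w : T).
Local Open Scope ereal_scope.

Lemma L1E f : L1 f <-> cmeas f /\ norm_L1 f < +oo.
Proof. by split=> [[? ? ?]|[[? ?] ?]]; split. Qed.

Lemma L1_cmeas f : L1 f -> cmeas f.
Proof. by move=> /L1E[]. Qed.

Lemma norm_L1_ge0 f : 0 <= norm_L1 f.
Proof. by apply: integral_ge0 => z _; rewrite lee_fin rnorm_ge0. Qed.

Lemma norm_L1_fin f : L1 f -> norm_L1 f \is a fin_num.
Proof. by move=> /L1E[_ h]; rewrite ge0_fin_numE// norm_L1_ge0. Qed.

Lemma norm_L1D f g : cmeas f -> cmeas g ->
  norm_L1 (fun z => f z + g z)%R <= norm_L1 f + norm_L1 g.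
Proof.
move=> mf mg; rewrite /norm_L1 -ge0_integralD//=; last 4 first.
- by move=> z _; rewrite lee_fin rnorm_ge0.
- exact: measurable_rnormE.
- by move=> z _; rewrite lee_fin rnorm_ge0.
- exact: measurable_rnormE.
apply: ge0_le_integral => //=.
- by move=> z _; rewrite lee_fin rnorm_ge0.
- by apply: measurable_rnormE; exact: cmeasD.
- by apply: emeasurable_funD; exact: measurable_rnormE.
- by move=> z _; rewrite lee_fin rnormD.
Qed.

Lemma norm_L1N f : norm_L1 (fun z => - f z)%R = norm_L1 f.
Proof. by apply: eq_integral => z _; rewrite rnormN. Qed.

Lemma norm_L1_distC f g :
  norm_L1 (fun z => f z - g z)%R = norm_L1 (fun z => g z - f z)%R.
Proof. by apply: eq_integral => z _; rewrite rnormB. Qed.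

Lemma norm_L1_triangle h f g : cmeas f -> cmeas g -> cmeas h ->
  norm_L1 (fun z => f z - g z)%R <=
  norm_L1 (fun z => f z - h z)%R + norm_L1 (fun z => h z - g z)%R.
Proof.
move=> mf mg mh; rewrite (_ : (fun z => f z - g z)%R =
  (fun z => (f z - h z) + (h z - g z))%R); last first.
  by apply/funext => z; rewrite subrKA.
by apply: norm_L1D; exact: cmeasB.
Qed.

Lemma norm_L1M_le f b (M : R) : cmeas f -> cmeas b -> (0 <= M)%R ->
  (forall z, (rnorm (b z) <= M)%R) ->
  norm_L1 (fun z => b z * f z)%R <= M%:E * norm_L1 f.
Proof.
move=> mf mb M0 hM; rewrite /norm_L1 -ge0_integralZl//; last 2 first.
- exact: measurable_rnormE.
- by move=> z _; rewrite lee_fin rnorm_ge0.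
apply: ge0_le_integral => //=.
- by move=> z _; rewrite lee_fin rnorm_ge0.
- by apply: measurable_rnormE; exact: cmeasM.
- by apply: emeasurable_funM => //; exact: measurable_rnormE.
- by move=> z _; rewrite lee_fin rnormM ler_wpM2r ?rnorm_ge0.
Qed.

Lemma L1D f g : L1 f -> L1 g -> L1 (fun z => f z + g z)%R.
Proof.
move=> /L1E[mf hf] /L1E[mg hg]; apply/L1E; split; first exact: cmeasD.
by rewrite (le_lt_trans (norm_L1D mf mg))// lte_add_pinfty.
Qed.

Lemma L1N f : L1 f -> L1 (fun z => - f z)%R.
Proof. by move=> /L1E[mf hf]; apply/L1E; rewrite norm_L1N; split => //; exact: cmeasN. Qed.

Lemma L1B f g : L1 f -> L1 g -> L1 (fun z => f z - g z)%R.
Proof. by move=> hf hg; apply: L1D => //; exact: L1N. Qed.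

Lemma L1M f b (M : R) : L1 f -> cmeas b -> (forall z, (rnorm (b z) <= M)%R) ->
  L1 (fun z => b z * f z)%R.
Proof.
move=> /[dup] L1f /L1E[mf hf] mb hM; apply/L1E; split; first exact: cmeasM.
have M0 : (0 <= M)%R by exact: le_trans (rnorm_ge0 _) (hM point).
rewrite (le_lt_trans (norm_L1M_le mf mb M0 hM))//.
by rewrite lte_mul_pinfty// norm_L1_ge0.
Qed.

Lemma L1_bounded f (M : R) : cmeas f -> (forall z, (rnorm (f z) <= M)%R) ->
  norm_L1 f <= M%:E /\ L1 f.
Proof.
move=> mf hM; have h : norm_L1 f <= M%:E.
  apply: (@le_trans _ _ (\int[m]_z M%:E)).
    apply: ge0_le_integral => //=.
    - by move=> z _; rewrite lee_fin rnorm_ge0.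
    - exact: measurable_rnormE.
    - by move=> z _; rewrite lee_fin.
  by rewrite integral_cst//= probability_setT mule1.
by split => //; apply/L1E; split => //; rewrite (le_lt_trans h)// ltry.
Qed.

Lemma L1_cst (a : R[i]) : L1 (fun=> a).
Proof. by have [] := @L1_bounded (fun=> a) (rnorm a) (cmeas_cst a) (fun=> lexx _). Qed.

Lemma L1Z (a : R[i]) f : L1 f -> L1 (fun z => a * f z)%R.
Proof.
by move=> hf; apply: (@L1M _ (fun=> a) (rnorm a)) => //; exact: cmeas_cst.
Qed.

Lemma L1_circleXz (n : int) : L1 (fun z => circle_val z ^ n)%R.
Proof.
apply: (proj2 (@L1_bounded _ 1 (cmeas_circleXz n) _)) => z.
by rewrite rnorm_circleXz.
Qed.

Lemma L1_Xz (n : int) f : L1 f -> L1 (fun z => f z * circle_val z ^ n)%R.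
Proof.
move=> hf; rewrite (_ : (fun z => _) = (fun z => circle_val z ^ n * f z)%R).
  by apply: (L1M hf (cmeas_circleXz n)) => z; rewrite rnorm_circleXz.
by apply/funext => z; rewrite mulrC.
Qed.

Lemma L1_sum I (r : seq I) (P : pred I) (F : I -> T -> R[i]) :
  (forall i, L1 (F i)) -> L1 (fun z => \sum_(i <- r | P i) F i z)%R.
Proof.
move=> mF; elim: r => [|i r IH].
  rewrite (_ : (fun z => _) = fun=> 0%R); first exact: L1_cst.
  by apply/funext => z; rewrite big_nil.
rewrite (_ : (fun z => _) =
  fun z => ((if P i then F i z else 0) + \sum_(j <- r | P j) F j z)%R).
  by apply: L1D => //; case: (P i) => //; exact: L1_cst.
by apply/funext => z; rewrite big_cons; case: (P i); rewrite ?add0r.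
Qed.

Lemma L1_horner (p : {poly R[i]}) : L1 (fun z => p.[circle_val z])%R.
Proof.
apply: (proj2 (@L1_bounded _ (l1 p) (cmeas_horner p) _)) => z.
by rewrite rnorm_horner_le// rnorm_circle.
Qed.

Lemma integrable_Re f : L1 f -> m.-integrable [set: T] (fun z => (complex.Re (f z))%:E).
Proof.
move=> /L1E[[m1 m2] h]; apply/integrableP; split; first exact/measurable_EFinP.
apply: le_lt_trans h; apply: ge0_le_integral => //=.
- exact/measurable_EFinP/measurableT_comp.
- exact: measurable_rnormE.
- by move=> z _; rewrite lee_fin normRe_le_rnorm.
Qed.

Lemma integrable_Im f : L1 f -> m.-integrable [set: T] (fun z => (complex.Im (f z))%:E).
Proof.
move=> /L1E[[m1 m2] h]; apply/integrableP; split; first exact/measurable_EFinP.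
apply: le_lt_trans h; apply: ge0_le_integral => //=.
- exact/measurable_EFinP/measurableT_comp.
- exact: measurable_rnormE.
- by move=> z _; rewrite lee_fin normIm_le_rnorm.
Qed.

Lemma L1_ReIm (g h : T -> R) : m.-integrable [set: T] (EFin \o g) ->
  m.-integrable [set: T] (EFin \o h) -> L1 (fun z => g z +i* h z)%R.
Proof.
move=> ig ih; have /measurable_EFinP mg := measurable_int _ ig.
have /measurable_EFinP mh := measurable_int _ ih.
apply/L1E; split; first by split.
have /integrableP[_ hg] := ig; have /integrableP[_ hh] := ih.
apply: (@le_lt_trans _ _ (\int[m]_z (`|(EFin \o g) z| + `|(EFin \o h) z|))).
  apply: ge0_le_integral => //=.
  - by move=> z _; rewrite lee_fin rnorm_ge0.
  - by apply: measurable_rnormE.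
  - by apply: emeasurable_funD; exact/measurable_EFinP/measurableT_comp.
  - by move=> z _; rewrite -EFinD lee_fin; exact: rnorm_le_ReIm.
rewrite ge0_integralD//=; last 2 first.
- exact/measurable_EFinP/measurableT_comp.
- exact/measurable_EFinP/measurableT_comp.
by rewrite lte_add_pinfty.
Qed.

Lemma L1_rnorm f : L1 f -> L1 (fun z => (rnorm (f z))%:C)%R.
Proof.
move=> /L1E[mf h]; apply/L1E; split; first by apply: cmeasC; exact: measurable_rnorm.
by rewrite /norm_L1; under eq_integral do rewrite rnormR ger0_norm ?rnorm_ge0//.
Qed.

End L1_theory.

(** * The complex integral *)

Section complex_integral.
Context {R : realType}.
Local Notation T := (circle R).
Local Notation m := (@circle_measure R).
Implicit Types (f g : T -> R[i]) (z w : T).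

(** The integral of a complex function. *)
Definition cint f : R[i] :=
  (\int[m]_z complex.Re (f z)) +i* (\int[m]_z complex.Im (f z)).

Lemma cintD f g : L1 f -> L1 g -> cint (fun z => f z + g z) = cint f + cint g.
Proof.
move=> hf hg; rewrite /cint.
have -> : \int[m]_z complex.Re (f z + g z) =
    \int[m]_z (complex.Re (f z) + complex.Re (g z)).
  by apply: eq_Rintegral => z _; case: (f z); case: (g z).
have -> : \int[m]_z complex.Im (f z + g z) =
    \int[m]_z (complex.Im (f z) + complex.Im (g z)).
  by apply: eq_Rintegral => z _; case: (f z); case: (g z).
rewrite !RintegralD//; [exact: integrable_Im|exact: integrable_Im|
  exact: integrable_Re|exact: integrable_Re].
Qed.

Lemma cintZ (a : R[i]) f : L1 f -> cint (fun z => a * f z) = a * cint f.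
Proof.
move=> hf; case: a => a b; rewrite /cint.
have iR := integrable_Re hf; have iI := integrable_Im hf.
have -> : \int[m]_z complex.Re ((a +i* b) * f z) =
    \int[m]_z (a * complex.Re (f z) - b * complex.Im (f z)).
  by apply: eq_Rintegral => z _; case: (f z).
have -> : \int[m]_z complex.Im ((a +i* b) * f z) =
    \int[m]_z (a * complex.Im (f z) + b * complex.Re (f z)).
  by apply: eq_Rintegral => z _; case: (f z).
have iZ c (g : T -> R) : m.-integrable [set: T] (fun z => (g z)%:E) ->
    m.-integrable [set: T] (fun z => (c * g z)%:E).
  by move=> ig; exact: (integrableZl _ c ig).
rewrite RintegralB ?RintegralD ?RintegralZl//; exact: iZ.
Qed.

Lemma cint0 : cint (fun=> 0) = 0.
Proof. by rewrite /cint/= /Rintegral integral0. Qed.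

Lemma cint_sum I (r : seq I) (P : pred I) (F : I -> T -> R[i]) :
  (forall i, L1 (F i)) -> cint (fun z => \sum_(i <- r | P i) F i z) =
  \sum_(i <- r | P i) cint (F i).
Proof.
move=> mF; elim: r => [|i r IH].
  rewrite big_nil -[RHS]cint0; congr cint.
  by apply/funext => z; rewrite big_nil.
rewrite big_cons; case: ifPn => Pi; last first.
  by rewrite -IH; congr cint; apply/funext => z; rewrite big_cons (negbTE Pi).
rewrite -IH -cintD//; last exact: L1_sum.
by congr cint; apply/funext => z; rewrite big_cons Pi.
Qed.

Lemma cint_cst (a : R[i]) : cint (fun=> a) = a.
Proof.
by rewrite /cint !Rintegral_cst//= probability_setT !mulr1; case: a.
Qed.

Lemma rnorm_cint_le f : L1 f -> ((rnorm (cint f))%:E <= norm_L1 f)%E.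
Proof.
move=> hf; have [->|c0] := eqVneq (cint f) 0; first by rewrite rnorm0 norm_L1_ge0.
(* rotate the integral onto the positive real axis *)
pose u : R[i] := `|cint f| / cint f.
have u1 : rnorm u = 1.
  apply: complexI; rewrite rnormE normf_div normr_id divff ?normr_eq0//.
have -> : rnorm (cint f) = complex.Re (cint (fun z => u * f z)).
  by rewrite cintZ// divfK// -rnormE.
have hu : L1 (fun z => u * f z) by exact: L1Z.
rewrite /cint/= /Rintegral fineK; last exact: integrable_fin_num (integrable_Re hu).
apply: (@le_trans _ _ (norm_L1 (fun z => u * f z))); last first.
  by rewrite /norm_L1; under eq_integral do rewrite rnormM u1 mul1r//.
apply: le_integral => //; first exact: integrable_Re.
- have -> : (fun z => (rnorm (u * f z))%:E) =
    (fun z => (complex.Re ((rnorm (u * f z))%:C))%:E) by [].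
  exact/integrable_Re/L1_rnorm.
- by move=> z _; rewrite lee_fin Re_le_rnorm.
Qed.

Lemma fourierE f n : fourier f n = cint (fun z => f z * circle_val z ^ (- n)).
Proof. by []. Qed.

End complex_integral.

(** * Orthogonality of the characters and Parseval's identity *)

Section orthogonality.
Context {R : realType}.
Local Notation T := (circle R).
Local Notation m := (@circle_measure R).
Implicit Types (f g : T -> R[i]) (z w : T).

(** The fundamental theorem of calculus on the circle, in the parameter [u] of
    [e ^ (i u)]. *)
Lemma circle_integral_FTC (g : T -> R) (f F : R -> R) :
  measurable_fun [set: T] g -> (forall z, 0 <= g z) ->
  (forall u : R, g (circle_expi u) = f u) -> continuous f ->
  (forall u : R, is_derive u (1 : R) F (f u)) ->
  (\int[m]_z (g z)%:E = ((2 * pi)^-1 * (F (2 * pi) - F 0))%:E)%E.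
Proof.
move=> mg g0 gf cf dF.
have cF : continuous F.
  by move=> u; apply: differentiable_continuous; apply/derivable1_diffP; case: (dF u).
rewrite ge0_integral_distribution//=; last exact/measurable_EFinP.
have -> : (\int[uniform_prob (@twopi_gt0 R)]_u (g (circle_expi u))%:E =
    \int[uniform_prob (@twopi_gt0 R)]_u (f u)%:E)%E.
  by apply: eq_integral => u _; rewrite gf.
rewrite integral_uniform; last 2 first.
- by apply/measurable_EFinP; exact: continuous_measurable_fun.
- by move=> u; rewrite lee_fin -gf.
rewrite (@continuous_FTC2 _ f F)//.
- by rewrite subr0 -EFinB -EFinM.
- exact: twopi_gt0.
- exact: continuous_subspaceT.
- split.
  + by move=> u _; case: (dF u).
  + exact/cvg_at_right_filter/cF.
  + exact/cvg_at_left_filter/cF.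
- by move=> u _; rewrite derive1E; apply: derive_val.
Qed.

Lemma expiX (u : R) n : expi u ^+ n = expi (n%:R * u) :> R[i].
Proof.
elim: n => [|n IH]; first by rewrite mul0r expr0 /expi cos0 sin0.
rewrite exprS IH -natr1 mulrDl mul1r addrC /expi cosD sinD /=.
by congr (_ +i* _); rewrite addrC.
Qed.


Lemma expi_2pi n : expi (n%:R * (2 * pi)) = 1 :> R[i].
Proof.
by rewrite -expiX /expi mulr_natl cos2pi sin2pi complexr0 expr1n.
Qed.

Lemma continuous_mulr_comp (h : R -> R) (k : R) :
  continuous h -> continuous (fun u => h (k * u)).
Proof.
move=> ch u; apply: continuous_comp; last exact: ch.
by apply: cvgM; [exact: cvg_cst|exact: cvg_id].
Qed.

Lemma cint_circleX n : (0 < n)%N -> cint (fun z => circle_val z ^+ n) = 0.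
Proof.
move=> n0; have nR : (n%:R : R) != 0 by rewrite pnatr_eq0 -lt0n.
have [mR mI] := cmeasX n (@cmeas_circle_val R).
have LX := L1_circleXz (Posz n) : L1 (fun z : T => circle_val z ^+ n).
have iR := integrable_Re LX; have iI := integrable_Im LX.
have cR z : 0 <= 1 + complex.Re (circle_val z ^+ n).
  have := normRe_le_rnorm (circle_val z ^+ n).
  by rewrite rnormX rnorm_circle expr1n ler_norml => /andP[]; lra.
have cI z : 0 <= 1 + complex.Im (circle_val z ^+ n).
  have := normIm_le_rnorm (circle_val z ^+ n).
  by rewrite rnormX rnorm_circle expr1n ler_norml => /andP[]; lra.
have pin : (2 * pi : R) != 0 by rewrite gt_eqF// twopi_gt0.
have [e1 e2] : cos (n%:R * (2 * pi) : R) = 1 /\ sin (n%:R * (2 * pi) : R) = 0.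
  by have := expi_2pi n; case.
have one : m.-integrable [set: T] (EFin \o cst 1) by exact: finite_measure_integrable_cst.
have h (g : T -> R) : m.-integrable [set: T] (fun z => (g z)%:E) ->
    (\int[m]_z (1 + g z)%:E = 1)%E -> \int[m]_z g z = 0.
  move=> ig; have : \int[m]_z (1 + g z) = 1 + \int[m]_z g z.
    by rewrite (RintegralD _ one ig)// Rintegral_cst//= probability_setT mulr1.
  move=> h1 h2; have : fine (\int[m]_z (1 + g z)%:E)%E = \int[m]_z (1 + g z) by [].
  by rewrite h2 h1 /=; lra.
have dC (u : R) : is_derive u (1 : R) (fun u => u + n%:R^-1 * sin (n%:R * u))
    (1 + cos (n%:R * u)).
  apply: is_derive_eq.
  by rewrite /GRing.scale /=; field.
have dS (u : R) : is_derive u (1 : R) (fun u => u - n%:R^-1 * cos (n%:R * u))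
    (1 + sin (n%:R * u)).
  apply: is_derive_eq.
  by rewrite /GRing.scale /=; field.
(* adding 1 makes the real and imaginary parts nonnegative *)
rewrite /cint; congr (_ +i* _); apply: h => //.
- rewrite (circle_integral_FTC _ cR _ _ dC).
  + by rewrite e2 !mulr0 sin0 mulr0 !addr0 subr0 mulVf.
  + exact: measurable_funD.
  + by move=> u; have -> : circle_val (circle_expi u) = expi u by []; rewrite expiX.
  + move=> u; apply: cvgD; first exact: cvg_cst.
    exact/continuous_mulr_comp/continuous_cos.
- rewrite (circle_integral_FTC _ cI _ _ dS).
  + by rewrite e1 [n%:R * 0]mulr0 cos0 sub0r opprK subrK mulVf.
  + exact: measurable_funD.
  + by move=> u; have -> : circle_val (circle_expi u) = expi u by []; rewrite expiX.
  + move=> u; apply: cvgD; first exact: cvg_cst.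
    exact/continuous_mulr_comp/continuous_sin.
Qed.

Lemma cint_conj f : L1 f -> cint (fun z => Num.conj (f z)) = Num.conj (cint f).
Proof.
move=> hf; have iI := integrable_Im hf.
rewrite /cint; have -> : \int[m]_z complex.Im (Num.conj (f z)) =
    -1 * \int[m]_z complex.Im (f z).
  rewrite -RintegralZl//; apply: eq_Rintegral => z _.
  by rewrite mulN1r; case: (f z).
have -> : \int[m]_z complex.Re (Num.conj (f z)) = \int[m]_z complex.Re (f z).
  by apply: eq_Rintegral => z _; case: (f z).
by rewrite mulN1r.
Qed.

Lemma cint_circleXz (n : int) : cint (fun z => circle_val z ^ n) = (n == 0)%:R.
Proof.
case: n => n.
  case: n => [|n]; last exact: cint_circleX.
  by rewrite eqxx -[RHS](cint_cst 1); congr cint; apply/funext => z.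
rewrite (_ : (fun z => _) = fun z => Num.conj (circle_val z ^+ n.+1)).
  by rewrite cint_conj ?cint_circleX ?rmorph0//; exact: (L1_circleXz (Posz n.+1)).
by apply/funext => z; rewrite /exprz -exprVn circle_val_inv rmorphXn.
Qed.

Lemma integral_Re f : L1 f ->
  (\int[m]_z (complex.Re (f z))%:E = (complex.Re (cint f))%:E)%E.
Proof.
by move=> hf; rewrite /cint/= /Rintegral fineK//; exact: integrable_fin_num (integrable_Re hf).
Qed.

Lemma circle_val_mul_conj z (i j : nat) :
  circle_val z ^+ i * Num.conj (circle_val z ^+ j) = circle_val z ^ (i%:Z - j%:Z).
Proof.
by rewrite expfzDr ?circle_val_neq0// -exprz_inv circle_val_inv rmorphXn.
Qed.

Lemma hdot_norm (H : hilbert R) (x : H) : ((rnorm x) ^+ 2)%:C = hdot H x x.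
Proof. by rewrite rmorphXn/= rnormE hdotE. Qed.

Lemma sqr_norm_trig (H : hilbert R) (v : nat -> H) (N : nat) z :
  (rnorm (\sum_(i < N) circle_val z ^+ i *: v i) ^+ 2)%:C =
  \sum_(i < N) \sum_(j < N) hdot H (v i) (v j) * circle_val z ^ (i%:Z - j%:Z).
Proof.
rewrite hdot_norm linear_sumlz /=; apply: eq_bigr => i _.
rewrite linear_sumr /=; apply: eq_bigr => j _.
by rewrite linearZl_LR linearZr_LR /= mulrA circle_val_mul_conj mulrC.
Qed.

(** [g] is measurable, nonnegative, and its integral is the real number [a]. *)
Definition has_integral (g : T -> R) (a : R) :=
  [/\ measurable_fun [set: T] g, forall z, 0 <= g z &
      (\int[m]_z (g z)%:E = a%:E)%E].

Lemma has_integralD (g h : T -> R) a b : has_integral g a -> has_integral h b ->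
  has_integral (fun z => g z + h z) (a + b).
Proof.
move=> [mg g0 gi] [mh h0 hi]; split.
- exact: measurable_funD.
- by move=> z; rewrite addr_ge0.
- under eq_integral do rewrite EFinD.
  by rewrite ge0_integralD//= ?gi ?hi// => [z _| |z _|];
    rewrite ?lee_fin//; exact/measurable_EFinP.
Qed.

Lemma has_integralZ (g : T -> R) a (k : R) : 0 <= k -> has_integral g a ->
  has_integral (fun z => k * g z) (k * a).
Proof.
move=> k0 [mg g0 gi]; split.
- exact: measurable_funM.
- by move=> z; rewrite mulr_ge0.
- under eq_integral do rewrite EFinM.
  rewrite ge0_integralZl//= ?gi ?lee_fin//.
  + exact/measurable_EFinP.
  + by move=> z _; rewrite lee_fin.
Qed.

Lemma has_integral_cst (k : R) : 0 <= k -> has_integral (fun=> k) k.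
Proof.
move=> k0; split => //.
by rewrite integral_cst//= probability_setT mule1.
Qed.

Lemma has_integral_sum N (g : nat -> T -> R) (a : nat -> R) :
  (forall i, (i < N)%N -> has_integral (g i) (a i)) ->
  has_integral (fun z => \sum_(i < N) g i z) (\sum_(i < N) a i).
Proof.
elim: N => [|N IH] h.
  rewrite big_ord0 (_ : (fun z => _) = fun=> 0); first exact: has_integral_cst.
  by apply/funext => z; rewrite big_ord0.
rewrite big_ord_recr/= (_ : (fun z => _) = fun z => \sum_(i < N) g i z + g N z).
  by apply: has_integralD; [apply: IH => i iN; apply: h; rewrite ltnS ltnW|exact: h].
by apply/funext => z; rewrite big_ord_recr.
Qed.

(** Parseval's identity for trigonometric polynomials with values in a Hilbert
    space. *)
Lemma parseval (H : hilbert R) (v : nat -> H) (N : nat) :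
  has_integral (fun z => rnorm (\sum_(i < N) circle_val z ^+ i *: v i) ^+ 2)
    (\sum_(i < N) rnorm (v i) ^+ 2).
Proof.
pose F z := \sum_(i < N) \sum_(j < N) hdot H (v i) (v j) * circle_val z ^ (i%:Z - j%:Z).
have FE z : rnorm (\sum_(i < N) circle_val z ^+ i *: v i) ^+ 2 = complex.Re (F z).
  by rewrite /F -sqr_norm_trig.
have L1F : L1 F.
  by apply: L1_sum => i; apply: L1_sum => j; apply: L1Z; exact: L1_circleXz.
split.
- by have [mF _] := L1_cmeas L1F; apply: eq_measurable_fun mF => z _; rewrite FE.
- by move=> z; rewrite sqr_ge0.
under eq_integral do rewrite FE.
rewrite integral_Re//; congr (_%:E); rewrite cint_sum; last first.
  by move=> i; apply: L1_sum => j; apply: L1Z; exact: L1_circleXz.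
have -> : \sum_(i < N) rnorm (v i) ^+ 2 =
   complex.Re ((\sum_(i < N) rnorm (v i) ^+ 2)%:C) by [].
congr (complex.Re _); rewrite rmorph_sum /=; apply: eq_bigr => i _.
rewrite cint_sum; last by move=> j; apply: L1Z; exact: L1_circleXz.
rewrite (bigD1 i)//= cintZ; last exact: L1_circleXz.
rewrite cint_circleXz subrr eqxx mulr1 hdot_norm big1 ?addr0// => j ji.
rewrite cintZ; last exact: L1_circleXz.
rewrite cint_circleXz subr_eq0 eqz_nat; case: eqP => [ij|_]; last by rewrite mulr0.
by move: ji; rewrite -val_eqE /= ij eqxx.
Qed.

Lemma parseval_horner (p : {poly R[i]}) :
  has_integral (fun z => rnorm p.[circle_val z] ^+ 2)
    (\sum_(i < size p) rnorm p`_i ^+ 2).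
Proof.
have := @parseval (scalars_hilbert R) (fun i => p`_i) (size p).
congr has_integral; apply/funext => z; rewrite horner_coef.
by congr (rnorm _ ^+ 2); apply: eq_bigr => i _; exact: mulrC.
Qed.

End orthogonality.

(** * Finite orthonormal families *)

Section gram_schmidt.
Context {R : realType} (H : hilbert R).
Implicit Types (e : nat -> H) (u v w : H).

(** The first [n] terms of [e] are orthonormal. *)
Definition orthonormal_family n e :=
  forall i j, (i < n)%N -> (j < n)%N -> hdot H (e i) (e j) = (i == j)%:R.

(** For an orthonormal family, the orthogonal projection onto the span of its
    first [n] terms. *)
Definition ortho_proj n e v : H := \sum_(l < n) hdot H v (e l) *: e l.

Lemma ortho_projD n e u v :
  ortho_proj n e (u + v) = ortho_proj n e u + ortho_proj n e v.
Proof.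
rewrite /ortho_proj -big_split; apply: eq_bigr => l _ /=.
by rewrite linearDl scalerDl.
Qed.

Lemma ortho_projZ n e a v : ortho_proj n e (a *: v) = a *: ortho_proj n e v.
Proof.
rewrite /ortho_proj scaler_sumr; apply: eq_bigr => l _ /=.
by rewrite linearZl_LR /= scalerA.
Qed.

Lemma ortho_proj_sum n e N (v : nat -> H) (a : nat -> R[i]) :
  (forall j, (j < N)%N -> v j = ortho_proj n e (v j)) ->
  \sum_(j < N) a j *: v j = ortho_proj n e (\sum_(j < N) a j *: v j).
Proof.
elim: N => [|N IH] h.
  by rewrite !big_ord0 /ortho_proj big1// => l _; rewrite linear0l scale0r.
rewrite !big_ord_recr /= ortho_projD ortho_projZ -h// -IH// => j jN.
by apply: h; rewrite ltnS ltnW.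
Qed.

Lemma hdot_sum_family n e (a : nat -> R[i]) l : orthonormal_family n e ->
  (l < n)%N -> hdot H (\sum_(i < n) a i *: e i) (e l) = a l.
Proof.
move=> oe ln; rewrite linear_sumlz /= (bigD1 (Ordinal ln))//= linearZl_LR /=.
rewrite oe// eqxx mulr1 big1 ?addr0// => i il.
rewrite linearZl_LR /= oe//; case: eqP => [h|_]; last by rewrite mulr0.
by move: il; rewrite -val_eqE /= h eqxx.
Qed.

(** Finitely many vectors lie in the span of a finite orthonormal family. *)
Lemma gram_schmidt (vs : seq H) : exists n e, orthonormal_family n e /\
  forall v, v \in vs -> v = ortho_proj n e v.
Proof.
elim: vs => [|v vs [n [e [oe he]]]]; first by exists 0%N, (fun=> 0); split.
pose u := v - ortho_proj n e v.
have ul l : (l < n)%N -> hdot H u (e l) = 0.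
  by move=> ln; rewrite /u linearBl /= (hdot_sum_family (fun l => hdot H v (e l)))// subrr.
have [u0|u0] := eqVneq u 0.
  exists n, e; split => // w; rewrite inE => /orP[/eqP ->|]; last exact: he.
  by apply/eqP; rewrite -subr_eq0; apply/eqP.
have lu l : (l < n)%N -> hdot H (e l) u = 0.
  move=> ln; have -> : hdot H (e l) u = Num.conj (hdot H u (e l)).
    by rewrite (hermC (hdot H) (e l) u) expr0 mul1r.
  by rewrite ul// rmorph0.
have projE w : hdot H (ortho_proj n e w) u = 0.
  rewrite linear_sumlz /= big1// => l _.
  by rewrite linearZl_LR /= lu// mulr0.
pose r : R[i] := `|u|^-1.
have rc : Num.conj r = r by rewrite geC0_conj// invr_ge0.
have uu : hdot H u u = r^-1 ^+ 2 by rewrite hdotE /r invrK.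
have r0 : r != 0 by rewrite invr_neq0// normr_eq0.
pose e' l := if (l < n)%N then e l else r *: u.
have e'l l : (l < n)%N -> e' l = e l by rewrite /e' => ->.
have e'n : e' n = r *: u by rewrite /e' ltnn.
have projE' w : ortho_proj n.+1 e' w =
    ortho_proj n e w + (r ^+ 2 * hdot H w u) *: u.
  rewrite /ortho_proj big_ord_recr /= e'n; congr (_ + _).
    by apply: eq_bigr => l _; rewrite e'l.
  by rewrite linearZr_LR /= rc scalerA mulrAC -expr2 .
exists n.+1, e'; split.
  move=> i j; rewrite ltnS leq_eqVlt => /orP[/eqP ->|ni];
    rewrite ltnS leq_eqVlt => /orP[/eqP ->|nj].
  - rewrite e'n linearZl_LR linearZr_LR /= rc uu mulrA -expr2 eqxx.
    by rewrite -exprMn divff// expr1n.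
  - rewrite e'n e'l// linearZl_LR /= ul// mulr0.
    by case: eqP nj => // ->; rewrite ltnn.
  - rewrite e'n e'l// linearZr_LR /= lu// mulr0.
    by case: eqP ni => // ->; rewrite ltnn.
  - by rewrite !e'l// oe.
move=> w; rewrite inE => /orP[/eqP ->|wvs]; rewrite projE'.
  have -> : hdot H v u = r^-1 ^+ 2.
    have {1}-> : v = ortho_proj n e v + u by rewrite addrC subrK.
    by rewrite linearDl /= projE add0r uu.
  by rewrite -exprMn mulfV// expr1n scale1r addrC subrK.
by rewrite [in X in _ + X](he _ wvs) projE mulr0 scale0r addr0; exact: he.
Qed.

Lemma rnorm_ortho_proj n e (a : nat -> R[i]) : orthonormal_family n e ->
  rnorm (\sum_(i < n) a i *: e i) ^+ 2 = \sum_(i < n) rnorm (a i) ^+ 2.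
Proof.
move=> oe; apply: complexI; rewrite hdot_norm rmorph_sum /= linear_sumr /=.
apply: eq_bigr => i _; rewrite linearZr_LR /= hdot_sum_family//.
by rewrite mulrC -rnorm_mulC.
Qed.

(** The Cauchy-Schwarz inequality, in the additive form which can be integrated
    termwise. *)
Lemma ortho_proj_amgm n e w (b : nat -> R[i]) (t : R) :
  orthonormal_family n e -> 0 < t -> w = ortho_proj n e w ->
  rnorm (\sum_(l < n) hdot H w (e l) * b l) <=
  2^-1 * (t * (\sum_(l < n) rnorm (b l) ^+ 2) + t^-1 * rnorm w ^+ 2).
Proof.
move=> oe t0 wE; rewrite (le_trans (rnorm_sum _ _ _))//.
have -> : rnorm w ^+ 2 = \sum_(l < n) rnorm (hdot H w (e l)) ^+ 2.
  by rewrite {1}wE (@rnorm_ortho_proj n e (fun l => hdot H w (e l))).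
rewrite !mulr_sumr -big_split mulr_sumr; apply: ler_sum => l _ /=.
rewrite rnormM; set x := rnorm (hdot _ _ _); set y := rnorm _.
have : 0 <= t * (y - t^-1 * x) ^+ 2 by rewrite mulr_ge0 ?sqr_ge0// ltW.
have -> : t * (y - t^-1 * x) ^+ 2 = t * y ^+ 2 - 2 * (x * y) + t^-1 * x ^+ 2.
  by field; rewrite gt_eqF.
lra.
Qed.

Variable f : {linear H -> scalars_hilbert R}.

(** A bounded functional is square summable along an orthonormal family. *)
Lemma functional_bessel n e (c : R) : orthonormal_family n e -> 0 <= c ->
  (forall x, rnorm (f x) <= c * rnorm x) ->
  \sum_(l < n) rnorm (f (e l)) ^+ 2 <= c ^+ 2.
Proof.
move=> oe c0 hf; set S := \sum_(l < n) _.
pose x : H := \sum_(l < n) Num.conj (f (e l) : R[i]) *: e l.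
have S0 : 0 <= S by apply: sumr_ge0 => l _; rewrite sqr_ge0.
have fx : (f x : R[i]) = S%:C.
  rewrite linear_sum rmorph_sum; apply: eq_bigr => l _ /=.
  by rewrite linearZ /= rnorm_mulC mulrC.
have xx : rnorm x ^+ 2 = S.
  rewrite (@rnorm_ortho_proj n e (fun l => Num.conj (f (e l) : R[i])) oe).
  by apply: eq_bigr => l _; rewrite rnorm_conj.
have := hf x; have -> : rnorm (f x) = S.
  have -> : rnorm (f x) = rnorm (S%:C : R[i]) by rewrite -fx.
  by rewrite rnormR ger0_norm.
rewrite -xx; set y := rnorm x => h; have y0 : 0 <= y by exact: rnorm_ge0.
have [->|yn] := eqVneq y 0; first by rewrite expr0n sqr_ge0.
have : y <= c by rewrite -(ler_pM2r (_ : 0 < y)) -?expr2// lt_def yn.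
by move=> yc; rewrite lerXn2r ?nnegrE.
Qed.

End gram_schmidt.

(** * Maxima of finitely many terms *)

Section running_max.
Context {R : realType}.

(** The maximum of [0] and of the first [K] terms of [u]. *)
Fixpoint running_max (u : nat -> R) (K : nat) : R :=
  if K is k.+1 then Num.max (running_max u k) (u k) else 0.

Lemma running_max_ge0 u K : 0 <= running_max u K.
Proof. by elim: K => //= K IH; rewrite le_max IH. Qed.

Lemma le_running_max u K k : (k < K)%N -> u k <= running_max u K.
Proof.
elim: K => //= K IH; rewrite ltnS leq_eqVlt => /orP[/eqP ->|kK].
  by rewrite le_max lexx orbT.
by rewrite le_max IH.
Qed.

Lemma running_max_le u K b : 0 <= b -> (forall k, (k < K)%N -> u k <= b) ->
  running_max u K <= b.
Proof.
move=> b0; elim: K => //= K IH h; rewrite ge_max h// andbT.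
by apply: IH => k kK; apply: h; rewrite ltnS ltnW.
Qed.

Lemma measurable_running_max d (X : measurableType d) (u : nat -> X -> R) K :
  (forall k, measurable_fun [set: X] (u k)) ->
  measurable_fun [set: X] (fun x => running_max (u ^~ x) K).
Proof.
move=> mu; elim: K => [|K IH] /=; first exact: measurable_cst.
exact: measurable_maxr.
Qed.

End running_max.

(** * The estimate for polynomials *)

Section polynomial_estimate.
Context {R : realType}.
Local Notation T := (circle R).
Local Notation m := (@circle_measure R).
Local Notation C := (scalars_hilbert R).
Implicit Types (p q h g : {poly R[i]}) (z w : T).

Lemma multp_monomial (f : nat -> R[i]) (a : R[i]) n :
  multp f (a *: 'X^n) = (a * f n) *: 'X^n.
Proof.
apply/polyP => k; rewrite coef_multp !coefZ coefXn.
by case: eqP => [->|_]; rewrite ?mulr1// !mulr0 mul0r.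
Qed.

Lemma multp_sum (f : nat -> R[i]) I (r : seq I) (P : pred I) (F : I -> {poly R[i]}) :
  multp f (\sum_(i <- r | P i) F i) = \sum_(i <- r | P i) multp f (F i).
Proof.
apply: (big_morph (multp f)); first exact: multpD.
by apply/polyP => n; rewrite coef_multp !coef0 mul0r.
Qed.

Lemma horner_multpM (f : nat -> R[i]) h g (x : R[i]) :
  (multp f (h * g)).[x] = \sum_(i < size h) \sum_(j < size g)
    h`_i * x ^+ i * (g`_j * x ^+ j * f (i + j)%N).
Proof.
rewrite -{1}[h]coefK -{1}[g]coefK !poly_def mulr_suml multp_sum horner_sum.
apply: eq_bigr => i _; rewrite mulr_sumr multp_sum horner_sum.
apply: eq_bigr => j _.
rewrite -scalerAl -scalerAr -exprD scalerA multp_monomial hornerZ hornerXn exprD.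
by ring.
Qed.

(** A factorization of [phi (i + j + k)] through two Hilbert spaces, by operators
    satisfying given bounds. *)
Record factored (phi : nat -> R[i]) (c1 c2 c3 : R) := Factored {
  fact_H1 : hilbert R;
  fact_H2 : hilbert R;
  fact_1 : nat -> {linear fact_H1 -> C};
  fact_2 : nat -> {linear fact_H2 -> fact_H1};
  fact_3 : nat -> {linear C -> fact_H2};
  fact_bound1 : forall t x, rnorm (fact_1 t x) <= c1 * rnorm x;
  fact_bound2 : forall t x, rnorm (fact_2 t x) <= c2 * rnorm x;
  fact_bound3 : forall t x, rnorm (fact_3 t x) <= c3 * rnorm x;
  factE : forall i j k,
    phi (i + j + k)%N = fact_1 i (fact_2 j (fact_3 k (1 : R[i]))) }.

Variables (phi : nat -> R[i]) (c1 c2 c3 : R).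
Hypotheses (c1_gt0 : 0 < c1) (c2_gt0 : 0 < c2) (c3_gt0 : 0 < c3).
Variable (F : factored phi c1 c2 c3).
Local Notation H1 := (fact_H1 F).
Local Notation H2 := (fact_H2 F).
Local Notation xi1 := (fact_1 F).
Local Notation xi2 := (fact_2 F).
Local Notation xi3 := (fact_3 F).

Lemma fact_3_1 j : rnorm (xi3 j (1 : R[i])) <= c3.
Proof.
rewrite (le_trans (fact_bound3 F j _))//.
have -> : rnorm ((1 : R[i]) : C) = 1 by exact: rnorm1.
by rewrite mulr1.
Qed.

Lemma factored_bound n : rnorm (phi n) <= c1 * c2 * c3.
Proof.
have := factE F n 0 0; rewrite !addn0 => ->.
rewrite (le_trans (fact_bound1 _ _))// -!mulrA ler_wpM2l//; first exact: ltW.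
rewrite (le_trans (fact_bound2 _ _))// ler_wpM2l//; first exact: ltW.
exact: fact_3_1.
Qed.

(** The supremum over the shifts [k < K] of the multiplier applied to a
    polynomial. *)
Definition max_shift K p z : R := running_max
  (fun k => rnorm (multp (fun n => phi (n + k)%N) p).[circle_val z]) K.

Lemma max_shift_ge0 K p z : 0 <= max_shift K p z.
Proof. exact: running_max_ge0. Qed.

Lemma measurable_max_shift K p : measurable_fun [set: T] (max_shift K p).
Proof.
by apply: measurable_running_max => k; apply: measurable_rnorm; exact: cmeas_horner.
Qed.

(* The vector-valued trigonometric polynomials attached to the two factors. *)
Let G g z : H2 := \sum_(j < size g) circle_val z ^+ j *: (g`_j *: xi3 j (1 : R[i])).
Let U h (e : H1) z : C := \sum_(i < size h) circle_val z ^+ i *: (h`_i *: xi1 i e).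

Lemma G_integral g : exists2 a, has_integral (fun z => rnorm (G g z) ^+ 2) a &
  a <= c3 ^+ 2 * \sum_(j < size g) rnorm g`_j ^+ 2.
Proof.
exists (\sum_(j < size g) rnorm (g`_j *: xi3 j (1 : R[i])) ^+ 2).
  exact: (parseval (fun j => g`_j *: xi3 j (1 : R[i]))).
rewrite mulr_sumr; apply: ler_sum => j _; rewrite mulrC.
have -> : rnorm (g`_j *: xi3 j (1 : R[i])) = rnorm g`_j * rnorm (xi3 j (1 : R[i])).
  by apply: complexI; rewrite rmorphM /= !rnormE normrZ.
rewrite exprMn ler_wpM2l ?sqr_ge0// lerXn2r ?nnegrE ?rnorm_ge0//; first exact: ltW.
exact: fact_3_1.
Qed.

Lemma U_integral h n e : orthonormal_family n e ->
  exists2 a, has_integral (fun z => \sum_(l < n) rnorm (U h (e l) z) ^+ 2) a &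
  a <= c1 ^+ 2 * \sum_(i < size h) rnorm h`_i ^+ 2.
Proof.
move=> oe.
exists (\sum_(l < n) \sum_(i < size h) rnorm (h`_i *: xi1 i (e l)) ^+ 2).
  apply: (@has_integral_sum _ n (fun l z => rnorm (U h (e l) z) ^+ 2)
    (fun l => \sum_(i < size h) rnorm (h`_i *: xi1 i (e l)) ^+ 2)) => l _.
  exact: (parseval (fun i => h`_i *: xi1 i (e l))).
rewrite exchange_big /= mulr_sumr; apply: ler_sum => i _.
have -> : \sum_(l < n) rnorm (h`_i *: xi1 i (e l)) ^+ 2 =
    rnorm h`_i ^+ 2 * \sum_(l < n) rnorm (xi1 i (e l)) ^+ 2.
  rewrite mulr_sumr; apply: eq_bigr => l _; rewrite -exprMn; congr (_ ^+ 2).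
  by apply: complexI; rewrite rmorphM /= !rnormE normrZ.
rewrite mulrC ler_wpM2r ?sqr_ge0//; apply: functional_bessel => //.
  exact: ltW.
exact: fact_bound1.
Qed.

Lemma multp_factored h g k z :
  (multp (fun n => phi (n + k)%N) (h * g)).[circle_val z] =
  \sum_(i < size h) h`_i * circle_val z ^+ i * (xi1 i (xi2 k (G g z)) : R[i]).
Proof.
rewrite horner_multpM; apply: eq_bigr => i _.
rewrite -mulr_sumr; congr (_ * _).
rewrite /G linear_sum linear_sum /=; apply: eq_bigr => j _.
rewrite !scalerA !linearZ /= mulrC [g`_j * _]mulrC.
by rewrite addnAC (factE F) mulrC.
Qed.

(** The supremum over the shifts is dominated by a function which does not
    involve them. The norm of the functional [\sum_i h_i z ^ i xi1 i] on [H1] is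
    replaced by the sum of the squares of its values on a finite orthonormal
    family. *)
Lemma pointwise_factored h g K : exists n e, orthonormal_family n e /\
  forall k z t, (k < K)%N -> 0 < t ->
  rnorm (multp (fun n => phi (n + k)%N) (h * g)).[circle_val z] <=
  2^-1 * (t * (\sum_(l < n) rnorm (U h (e l) z) ^+ 2) +
          t^-1 * (c2 ^+ 2 * rnorm (G g z) ^+ 2)).
Proof.
(* a finite-dimensional space containing all the vectors which occur *)
pose vs := [seq xi2 k (xi3 j (1 : R[i])) | k <- iota 0 K, j <- iota 0 (size g)].
have [n [e [oe he]]] := gram_schmidt vs.
exists n, e; split => // k z t kK t0.
set w := xi2 k (G g z).
have wE : w = ortho_proj n e w.
  have -> : w = \sum_(j < size g)
      (circle_val z ^+ j * g`_j) *: xi2 k (xi3 j (1 : R[i])).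
    by rewrite /w /G linear_sum; apply: eq_bigr => j _; rewrite scalerA linearZ.
  apply: (@ortho_proj_sum _ _ n e (size g) (fun j => xi2 k (xi3 j (1 : R[i])))
    (fun j => circle_val z ^+ j * g`_j)) => j jg.
  by apply: he; apply: allpairs_f; rewrite mem_iota.
have -> : (multp (fun n => phi (n + k)%N) (h * g)).[circle_val z] =
    \sum_(l < n) hdot H1 w (e l) * (U h (e l) z : R[i]).
  rewrite multp_factored -/w.
  under [RHS]eq_bigr do rewrite mulr_sumr.
  rewrite exchange_big /=; apply: eq_bigr => i _.
  rewrite {1}wE linear_sum mulr_sumr; apply: eq_bigr => l _ /=.
  rewrite linearZ /=.
  have -> : (circle_val z ^+ i *: (h`_i *: xi1 i (e l)) : R[i]) =
    circle_val z ^+ i * (h`_i * (xi1 i (e l) : R[i])) by [].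
  have -> : (hdot H1 w (e l) *: xi1 i (e l) : R[i]) =
    hdot H1 w (e l) * (xi1 i (e l) : R[i]) by [].
  by ring.
rewrite (le_trans (ortho_proj_amgm (fun l => U h (e l) z : R[i]) oe t0 wE))//.
rewrite ler_pM2l ?invr_gt0//.
rewrite lerD2l ler_pM2l ?invr_gt0// -exprMn lerXn2r ?nnegrE ?rnorm_ge0//.
  by rewrite mulr_ge0 ?rnorm_ge0// ltW.
exact: fact_bound2.
Qed.

Lemma max_shift_product h g K : exists2 a,
  (\int[m]_z (max_shift K (h * g) z)%:E <= a%:E)%E &
  a <= 2^-1 * (c1 * c2 * c3) *
    (\sum_(i < size h) rnorm h`_i ^+ 2 + \sum_(i < size g) rnorm g`_i ^+ 2).
Proof.
have [n [e [oe he]]] := pointwise_factored h g K.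
have [a1 i1 h1] := U_integral h oe.
have [a2 i2 h2] := G_integral g.
(* this value of t balances the two terms *)
pose t := c2 * c3 / c1.
have t0 : 0 < t by rewrite divr_gt0// mulr_gt0.
exists (2^-1 * (t * a1 + t^-1 * (c2 ^+ 2 * a2))).
  have I : has_integral (fun z => 2^-1 * (t * (\sum_(l < n) rnorm (U h (e l) z) ^+ 2) +
          t^-1 * (c2 ^+ 2 * rnorm (G g z) ^+ 2)))
      (2^-1 * (t * a1 + t^-1 * (c2 ^+ 2 * a2))).
    apply: has_integralZ; first by rewrite invr_ge0.
    apply: has_integralD; first exact: has_integralZ (ltW t0) i1.
    apply: has_integralZ; first by rewrite invr_ge0 ltW.
    by apply: has_integralZ => //; exact: sqr_ge0.
  case: I => mI I0 <-; apply: ge0_le_integral => //=.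
  - by move=> z _; rewrite lee_fin max_shift_ge0.
  - by apply/measurable_EFinP; exact: measurable_max_shift.
  - exact/measurable_EFinP.
  - move=> z _; rewrite lee_fin /max_shift.
    by apply: running_max_le => // k kK; exact: he.
set A := \sum_(i < size h) _ in h1 *; set B := \sum_(i < size g) _ in h2 *.
have -> : 2^-1 * (c1 * c2 * c3) * (A + B) =
    2^-1 * (t * (c1 ^+ 2 * A) + t^-1 * (c2 ^+ 2 * (c3 ^+ 2 * B))).
  by rewrite /t; field; rewrite !gt_eqF.
rewrite ler_pM2l ?invr_gt0// lerD// ler_pM2l ?invr_gt0// ler_pM2l// exprn_gt0//.
Qed.

Lemma max_shift_split K p q z :
  max_shift K p z <= max_shift K q z + l1 (p - q) * (c1 * c2 * c3).
Proof.
have l0 : 0 <= l1 (p - q) * (c1 * c2 * c3).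
  by rewrite mulr_ge0 ?l1_ge0// ltW// !mulr_gt0.
apply: running_max_le => [|k kK]; first by rewrite addr_ge0// max_shift_ge0.
rewrite -[p in multp _ p](subrK q) multpD hornerD addrC.
rewrite (le_trans (rnormD _ _))// lerD//.
  exact: (le_running_max
    (fun k => rnorm (multp (fun n => phi (n + k)%N) q).[circle_val z]) kK).
rewrite (le_trans (rnorm_horner_le _ _)) ?rnorm_circle// l1_multp// => j.
exact: factored_bound.
Qed.

Lemma sqr_coef_le p q (d r : R) : 0 <= d ->
  norm_L1 (fun z => p.[circle_val z]) = r%:E ->
  (forall x : R[i], rnorm x = 1 -> rnorm q.[x] ^+ 2 <= rnorm p.[x] + d) ->
  \sum_(i < size q) rnorm q`_i ^+ 2 <= r + d.
Proof.
move=> d0 nE hq; have [mq q0 qi] := parseval_horner q.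
rewrite -lee_fin -qi EFinD -nE.
apply: (@le_trans _ _ (\int[m]_z ((rnorm p.[circle_val z])%:E + d%:E))%E).
  apply: ge0_le_integral => //=.
  - by move=> z _; rewrite lee_fin.
  - exact/measurable_EFinP.
  - by apply: emeasurable_funD => //; apply: measurable_rnormE; exact: cmeas_horner.
  - by move=> z _; rewrite -EFinD lee_fin hq// rnorm_circle.
rewrite ge0_integralD//=; last 2 first.
- by move=> z _; rewrite lee_fin rnorm_ge0.
- by apply: measurable_rnormE; exact: cmeas_horner.
by rewrite integral_cst//= probability_setT mule1.
Qed.

Lemma max_shift_le_approx K p h g (d r : R) : 0 <= d ->
  norm_L1 (fun z => p.[circle_val z]) = r%:E -> l1 (p - h * g) <= d ->
  (forall x : R[i], rnorm x = 1 -> rnorm h.[x] ^+ 2 <= rnorm p.[x] + d) ->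
  (forall x : R[i], rnorm x = 1 -> rnorm g.[x] ^+ 2 <= rnorm p.[x] + d) ->
  (\int[m]_z (max_shift K p z)%:E <= (c1 * c2 * c3 * (r + d + d))%:E)%E.
Proof.
move=> d0 nE lhg hh hg.
have c0 : 0 < c1 * c2 * c3 by rewrite !mulr_gt0.
have hS := sqr_coef_le d0 nE hh.
have gS := sqr_coef_le d0 nE hg.
have [a ia ha] := max_shift_product h g K.
apply: (@le_trans _ _ (\int[m]_z ((max_shift K (h * g) z)%:E +
    (d * (c1 * c2 * c3))%:E))%E).
  apply: ge0_le_integral => //=.
  - by move=> z _; rewrite lee_fin max_shift_ge0.
  - by apply/measurable_EFinP; exact: measurable_max_shift.
  - by apply: emeasurable_funD => //; apply/measurable_EFinP; exact: measurable_max_shift.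
  - move=> z _; rewrite -EFinD lee_fin (le_trans (max_shift_split _ _ (h * g) _))//.
    by rewrite lerD2l ler_pM2r.
rewrite ge0_integralD//=; last 3 first.
- by move=> z _; rewrite lee_fin max_shift_ge0.
- by apply/measurable_EFinP; exact: measurable_max_shift.
- by move=> z _; rewrite lee_fin mulr_ge0// ltW.
rewrite integral_cst//= probability_setT mule1.
apply: (@le_trans _ _ (a%:E + (d * (c1 * c2 * c3))%:E)%E); first by rewrite leeD2r.
rewrite -!EFinD lee_fin mulrDr [d * _]mulrC lerD2r (le_trans ha)//.
have -> : c1 * c2 * c3 * (r + d) = 2^-1 * (c1 * c2 * c3) * ((r + d) + (r + d)).
  by field.
by rewrite ler_pM2l ?lerD// mulr_gt0 ?invr_gt0.
Qed.

(** The main estimate, for polynomials. *)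
Lemma max_shift_le K p :
  (\int[m]_z (max_shift K p z)%:E <=
   (c1 * c2 * c3)%:E * norm_L1 (fun z => p.[circle_val z]))%E.
Proof.
have nE := fineK (norm_L1_fin (L1_horner p)).
set r := fine _ in nE; rewrite -nE -EFinM.
have c0 : 0 < c1 * c2 * c3 by rewrite !mulr_gt0.
apply/lee_addgt0Pr => eps eps0.
pose d : R := eps / (2 * (c1 * c2 * c3)).
have d0 : 0 < d by rewrite divr_gt0// mulr_gt0.
have [h [g [lhg hg]]] := poly_factorable p d0.
have hh x (Hx : rnorm x = 1) := (hg x Hx).1.
have gg x (Hx : rnorm x = 1) := (hg x Hx).2.
apply: (le_trans (max_shift_le_approx K (ltW d0) (esym nE) lhg hh gg)).
rewrite -EFinD lee_fin -addrA mulrDr lerD2l.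
have -> : d + d = eps / (c1 * c2 * c3).
  by rewrite /d; field; rewrite !gt_eqF.
by rewrite mulrC divfK// gt_eqF.
Qed.

End polynomial_estimate.

(** * Cesaro means of Fourier series *)

Section fejer.
Context {R : realType}.
Local Notation T := (circle R).
Local Notation m := (@circle_measure R).
Implicit Types (f g : T -> R[i]) (z w : T).

(** The Cesaro means of the Fourier series of [f]. *)
Definition fejer (N : nat) f z : R[i] := N.+1%:R^-1 *
  \sum_(i < N.+1) \sum_(j < N.+1)
    fourier f (i%:Z - j%:Z) * circle_val z ^ (i%:Z - j%:Z).

(** The Fejer kernel at [z / w], as a nonnegative function of two points of the
    circle. *)
Definition fejer_kernel (N : nat) z w : R := N.+1%:R^-1 *
  rnorm (\sum_(i < N.+1) (circle_val z * Num.conj (circle_val w)) ^+ i) ^+ 2.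

Lemma fejer_kernel_ge0 N z w : 0 <= fejer_kernel N z w.
Proof. by rewrite mulr_ge0 ?sqr_ge0// invr_ge0. Qed.

Lemma conj_circleXz w (n : int) :
  Num.conj (circle_val w ^ n) = circle_val w ^ (- n).
Proof.
by rewrite -exprz_inv circle_val_inv rmorphXz// unitfE circle_val_neq0.
Qed.

Lemma fejer_kernelE N z w : (fejer_kernel N z w)%:C = N.+1%:R^-1 *
  \sum_(i < N.+1) \sum_(j < N.+1)
    circle_val z ^ (i%:Z - j%:Z) * circle_val w ^ (- (i%:Z - j%:Z)).
Proof.
rewrite rmorphM/= fmorphV rmorph_nat rnorm_mulC rmorph_sum; congr (_ * _).
rewrite mulr_suml; apply: eq_bigr => i _; rewrite mulr_sumr; apply: eq_bigr => j _ /=.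
rewrite -!circle_val_mul_conj -conj_circleXz -circle_val_mul_conj !exprMn !rmorphM/=.
by rewrite !rmorphXn/= !conjCK; ring.
Qed.

Lemma L1_fejer_kernel N f z : L1 f -> L1 (fun w => f w * (fejer_kernel N z w)%:C).
Proof.
move=> hf; rewrite (_ : (fun w => _) = fun w => N.+1%:R^-1 *
   \sum_(i < N.+1) \sum_(j < N.+1)
    circle_val z ^ (i%:Z - j%:Z) * (f w * circle_val w ^ (- (i%:Z - j%:Z)))).
  by apply: L1Z; apply: L1_sum => i; apply: L1_sum => j; apply: L1Z; exact: L1_Xz.
apply/funext => w; rewrite fejer_kernelE mulrCA; congr (_ * _).
rewrite mulr_sumr; apply: eq_bigr => i _; rewrite mulr_sumr; apply: eq_bigr => j _.
by rewrite mulrCA.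
Qed.

Lemma fejerE N f z : L1 f ->
  fejer N f z = cint (fun w => f w * (fejer_kernel N z w)%:C).
Proof.
move=> hf; rewrite (_ : (fun w => _) = fun w => N.+1%:R^-1 *
   \sum_(i < N.+1) \sum_(j < N.+1)
    circle_val z ^ (i%:Z - j%:Z) * (f w * circle_val w ^ (- (i%:Z - j%:Z)))).
  rewrite cintZ; last first.
    by apply: L1_sum => i; apply: L1_sum => j; apply: L1Z; exact: L1_Xz.
  congr (_ * _); rewrite cint_sum; last first.
    by move=> i; apply: L1_sum => j; apply: L1Z; exact: L1_Xz.
  apply: eq_bigr => i _; rewrite cint_sum; last first.
    by move=> j; apply: L1Z; exact: L1_Xz.
  by apply: eq_bigr => j _; rewrite cintZ ?fourierE 1?mulrC//; exact: L1_Xz.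
apply/funext => w; rewrite fejer_kernelE mulrCA; congr (_ * _).
rewrite mulr_sumr; apply: eq_bigr => i _; rewrite mulr_sumr; apply: eq_bigr => j _.
by rewrite mulrCA.
Qed.

Lemma L1_fejer N f : L1 (fejer N f).
Proof.
apply: L1Z; apply: L1_sum => i; apply: L1_sum => j; apply: L1Z.
exact: L1_circleXz.
Qed.

Lemma cint_fejer N f : cint (fejer N f) = fourier f 0.
Proof.
rewrite cintZ; last first.
  apply: L1_sum => i; apply: L1_sum => j; apply: L1Z; exact: L1_circleXz.
rewrite cint_sum; last first.
  by move=> i; apply: L1_sum => j; apply: L1Z; exact: L1_circleXz.
rewrite (eq_bigr (fun=> fourier f 0)).
  by rewrite sumr_const card_ord -[X in _ * X]mulr_natl mulKf// pnatr_eq0.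
move=> i _; rewrite cint_sum; last by move=> j; apply: L1Z; exact: L1_circleXz.
rewrite (bigD1 i)//= cintZ; last exact: L1_circleXz.
rewrite cint_circleXz subrr eqxx mulr1 big1 ?addr0// => j ji.
rewrite cintZ; last exact: L1_circleXz.
rewrite cint_circleXz subr_eq0 eqz_nat; case: eqP => [ij|_]; last by rewrite mulr0.
by move: ji; rewrite -val_eqE /= ij eqxx.
Qed.

Lemma fourierB f g n : L1 f -> L1 g ->
  fourier (fun z => f z - g z) n = fourier f n - fourier g n.
Proof.
move=> hf hg; rewrite !fourierE.
have -> : cint (fun z => (f z - g z) * circle_val z ^ (- n)) =
   cint (fun z => f z * circle_val z ^ (- n) + -1 * (g z * circle_val z ^ (- n))).
  by congr cint; apply/funext => z; rewrite mulN1r mulrBl.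
rewrite cintD; [|exact: L1_Xz|by apply: L1Z; exact: L1_Xz].
by rewrite cintZ ?mulN1r//; exact: L1_Xz.
Qed.

Lemma fejerB N f g z : L1 f -> L1 g ->
  fejer N (fun z => f z - g z) z = fejer N f z - fejer N g z.
Proof.
move=> hf hg; rewrite /fejer -mulrBr -sumrB; congr (_ * _).
apply: eq_bigr => i _; rewrite -sumrB; apply: eq_bigr => j _.
by rewrite fourierB// mulrBl.
Qed.

Lemma rnorm_fejer_le N f z : L1 f ->
  ((rnorm (fejer N f z))%:E <=
   \int[m]_w (rnorm (f w) * fejer_kernel N z w)%:E)%E.
Proof.
move=> hf; rewrite fejerE// (le_trans (rnorm_cint_le (L1_fejer_kernel _ _ hf)))//.
rewrite le_eqVlt; apply/orP; left; apply/eqP; apply: eq_integral => w _.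
by rewrite rnormM rnormR ger0_norm// fejer_kernel_ge0.
Qed.

Lemma integral_fejer_kernel N (g : T -> R) z : L1 (fun w => (g w)%:C) ->
  (\int[m]_w (g w * fejer_kernel N z w)%:E =
   (complex.Re (fejer N (fun w => (g w)%:C) z))%:E)%E.
Proof.
move=> hg; rewrite fejerE// -integral_Re; last exact: L1_fejer_kernel.
by apply: eq_integral => w _; rewrite -rmorphM.
Qed.

Lemma fejer_cst N (a : R[i]) z : fejer N (fun=> a) z = a.
Proof.
rewrite /fejer (eq_bigr (fun=> a)).
  by rewrite sumr_const card_ord -[X in _ * X]mulr_natl mulKf// pnatr_eq0.
have fa n : fourier (fun=> a) n = a * (n == 0)%:R.
  by rewrite fourierE cintZ ?cint_circleXz ?oppr_eq0//; exact: L1_circleXz.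
move=> i _; rewrite (bigD1 i)//= fa subrr eqxx expr0z !mulr1 big1 ?addr0// => j ji.
rewrite fa subr_eq0 eqz_nat; case: eqP => [ij|_]; last by rewrite mulr0 mul0r.
by move: ji; rewrite -val_eqE /= ij eqxx.
Qed.

(** The Cesaro means are contractions of L^1: the mean of [f] is dominated by
    that of [|f|], whose integral is the Fourier coefficient of [|f|] at [0]. *)
Lemma norm_fejer_le N f : L1 f -> (norm_L1 (fejer N f) <= norm_L1 f)%E.
Proof.
move=> hf; have hn := L1_rnorm hf.
pose F := fejer N (fun w => (rnorm (f w))%:C).
have le z : ((rnorm (fejer N f z))%:E <= (complex.Re (F z))%:E)%E.
  by rewrite -integral_fejer_kernel// rnorm_fejer_le.
have [mR _] := L1_cmeas (L1_fejer N (fun w => (rnorm (f w))%:C)).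
apply: (@le_trans _ _ (\int[m]_z (complex.Re (F z))%:E)%E).
  apply: ge0_le_integral => //=.
  - by move=> z _; rewrite lee_fin rnorm_ge0.
  - by apply: measurable_rnormE; exact/L1_cmeas/L1_fejer.
  - exact/measurable_EFinP.
rewrite integral_Re ?cint_fejer ?fourierE; last exact: L1_fejer.
rewrite -integral_Re; last exact: L1_Xz.
by rewrite le_eqVlt; apply/orP; left; apply/eqP; apply: eq_integral => z _;
  rewrite oppr0 expr0z mulr1.
Qed.

(** The kernel times the square of the distance telescopes to
    [|1 - u ^ (N + 1)| ^ 2 / (N + 1)], where [u = z / w]. *)
Lemma fejer_kernel_dist N z w :
  rnorm (circle_val w - circle_val z) ^+ 2 * fejer_kernel N z w <= 4 / N.+1%:R.
Proof.
set u := circle_val z * Num.conj (circle_val w).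
have u1 : rnorm u = 1 by rewrite rnormM rnorm_conj !rnorm_circle mulr1.
have -> : rnorm (circle_val w - circle_val z) = rnorm (1 - u).
  have <- : (circle_val w - circle_val z) * Num.conj (circle_val w) = 1 - u.
    by rewrite mulrBl -[in X in X - _]circle_val_inv mulfV ?circle_val_neq0.
  by rewrite rnormM rnorm_conj rnorm_circle mulr1.
rewrite /fejer_kernel -/u mulrCA [leRHS]mulrC ler_pM2l ?invr_gt0//.
rewrite -exprMn -rnormM.
have -> : (1 - u) * \sum_(i < N.+1) u ^+ i = 1 - u ^+ N.+1.
  rewrite -[in RHS](expr1n _ N.+1) subrXX; congr (_ * _).
  by apply: eq_bigr => i _; rewrite expr1n mul1r.
have -> : (4 : R) = 2 ^+ 2 by ring.
rewrite lerXn2r ?nnegrE ?rnorm_ge0// (le_trans (rnormD _ _))//.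
by rewrite rnormN rnorm1 rnormX u1 expr1n.
Qed.

Lemma lipschitz_cmeas f (L : R) :
  (forall z w, rnorm (f z - f w) <= L * rnorm (circle_val z - circle_val w)) ->
  cmeas f.
Proof.
move=> hL; split; apply: (@lipschitz_measurable _ _ L) => z w.
  have -> : complex.Re (f z) - complex.Re (f w) = complex.Re (f z - f w).
    by case: (f z); case: (f w).
  exact: le_trans (normRe_le_rnorm _) (hL _ _).
have -> : complex.Im (f z) - complex.Im (f w) = complex.Im (f z - f w).
  by case: (f z); case: (f w).
exact: le_trans (normIm_le_rnorm _) (hL _ _).
Qed.

Lemma lipschitz_L1 f (L : R) :
  (forall z w, rnorm (f z - f w) <= L * rnorm (circle_val z - circle_val w)) ->
  L1 f.
Proof.
move=> hL; apply: (proj2 (@L1_bounded _ _ (rnorm (f point) + `|L| * 2)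
  (lipschitz_cmeas hL) _)) => z.
rewrite -[f z](subrK (f point)) addrC (le_trans (rnormD _ _))// lerD2l.
rewrite (le_trans (hL _ _))//; apply: (@le_trans _ _ (`|L| *
    rnorm (circle_val z - circle_val point))).
  by rewrite ler_wpM2r ?rnorm_ge0// ler_norm.
rewrite ler_wpM2l// (le_trans (rnormD _ _))// rnormN !rnorm_circle.
by rewrite -mulr2n.
Qed.

(** The Cesaro means of a Lipschitz function converge uniformly. *)
Lemma fejer_lipschitz f (L eps : R) : 0 < eps ->
  (forall z w, rnorm (f z - f w) <= L * rnorm (circle_val z - circle_val w)) ->
  exists N0, forall N z, (N0 <= N)%N -> rnorm (fejer N f z - f z) <= eps.
Proof.
move=> eps0 hL; pose M := L ^+ 2 / (2 * eps).
have M0 : 0 <= M by rewrite divr_ge0 ?sqr_ge0// mulr_ge0// ltW.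
(* the inequality L d <= eps / 2 + M d ^ 2 trades the distance for its square,
   which the kernel integrates to O(1 / N) *)
have hM z w : rnorm (f w - f z) <=
    eps / 2 + M * rnorm (circle_val w - circle_val z) ^+ 2.
  rewrite (le_trans (hL _ _))//; set d := rnorm _.
  have -> : eps / 2 + M * d ^+ 2 = L * d + (eps - L * d) ^+ 2 / (2 * eps).
    by rewrite /M; field; rewrite gt_eqF.
  by rewrite lerDl divr_ge0 ?sqr_ge0// mulr_ge0// ltW.
have [N0 hN0] : exists N0 : nat, 8 * M / eps <= N0%:R.
  exists (Num.bound (8 * M / eps)); apply/ltW/archi_boundP.
  by apply: divr_ge0; [exact: mulr_ge0|exact: ltW].
exists N0 => N z NN.
have hf := lipschitz_L1 hL.
have hfz : L1 (fun w => f w - f z) by apply: L1B => //; exact: L1_cst.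
have -> : fejer N f z - f z = fejer N (fun w => f w - f z) z.
  by rewrite fejerB ?fejer_cst//; exact: L1_cst.
have Nle : M * (4 / N.+1%:R) <= eps / 2.
  have hN : 8 * M <= eps * N.+1%:R.
    rewrite [leRHS]mulrC -ler_pdivrMr// (le_trans hN0)// ler_nat.
    by rewrite (leq_trans NN).
  rewrite mulrA ler_pdivrMr//; lra.
rewrite -lee_fin (le_trans (rnorm_fejer_le _ _ hfz))//.
have mk h : cmeas h -> measurable_fun [set: T] (fun w => rnorm (h w) * fejer_kernel N z w).
  move=> mh; apply: measurable_funM; first exact: measurable_rnorm.
  have [mR _] := L1_cmeas (L1_fejer_kernel N z (L1_cst 1)).
  by apply: eq_measurable_fun mR => w _; rewrite mul1r.
have mk1 : measurable_fun [set: T] (fejer_kernel N z).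
  have := mk _ (cmeas_cst 1); apply: eq_measurable_fun => w _.
  by rewrite rnorm1 mul1r.
apply: (@le_trans _ _ (\int[m]_w (eps / 2 * fejer_kernel N z w + M * (4 / N.+1%:R))%:E)%E).
  apply: ge0_le_integral => //=.
  - by move=> w _; rewrite lee_fin mulr_ge0 ?rnorm_ge0 ?fejer_kernel_ge0.
  - apply/measurable_EFinP; apply: (mk (fun w => f w - f z)).
    exact: L1_cmeas hfz.
  - by apply/measurable_EFinP; apply: measurable_funD => //; apply: measurable_funM.
  - move=> w _; rewrite lee_fin.
    apply: (@le_trans _ _ ((eps / 2 + M * rnorm (circle_val w - circle_val z) ^+ 2) *
      fejer_kernel N z w)).
      by rewrite ler_wpM2r ?fejer_kernel_ge0.
    by rewrite mulrDl lerD2l -mulrA ler_wpM2l// fejer_kernel_dist.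
under eq_integral do rewrite EFinD.
rewrite ge0_integralD//=; last 3 first.
- by move=> w _; rewrite lee_fin mulr_ge0 ?fejer_kernel_ge0// ltW// divr_gt0.
- by apply/measurable_EFinP; apply: measurable_funM.
- by move=> w _; rewrite lee_fin mulr_ge0// divr_ge0.
rewrite integral_cst//= probability_setT mule1.
rewrite (@integral_fejer_kernel N (fun=> eps / 2)); last exact: L1_cst.
by rewrite fejer_cst /= -EFinD lee_fin [leRHS]splitr lerD2l.
Qed.

End fejer.

(** * Density of Lipschitz functions in L^1 *)

Section lipschitz_density.
Context {R : realType}.
Local Notation T := (circle R).
Local Notation m := (@circle_measure R).
Implicit Types (f g : T -> R) (z w : T) (A : set T).

(** Lipschitz functions for the distance induced by the complex plane. *)
Definition lipschitz_circle (L : R) f :=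
  forall z w, `|f z - f w| <= L * rnorm (circle_val z - circle_val w).

(** [f] is a limit in L^1 of Lipschitz functions. *)
Definition lip_approx f := measurable_fun [set: T] f /\
  forall eps : R, 0 < eps -> exists g L, lipschitz_circle L g /\
    (\int[m]_z (`|f z - g z|)%:E <= eps%:E)%E.

Lemma lipschitz_circle_measurable L f : lipschitz_circle L f ->
  measurable_fun [set: T] f.
Proof. exact: lipschitz_measurable. Qed.

Lemma lip_approx_lipschitz L f : lipschitz_circle L f -> lip_approx f.
Proof.
move=> hf; split; first exact: lipschitz_circle_measurable hf.
move=> eps eps0; exists f, L; split => //.
under eq_integral do rewrite subrr normr0.
by rewrite integral0 lee_fin ltW.
Qed.

Lemma measurable_norm_sub f g : measurable_fun [set: T] f ->
  measurable_fun [set: T] g ->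
  measurable_fun [set: T] (fun z => (`|f z - g z|)%:E).
Proof.
move=> mf mg; apply/measurable_EFinP; apply: measurableT_comp => //.
exact: measurable_funB.
Qed.

Lemma integral_norm_triangle (h f g : T -> R) : measurable_fun [set: T] f ->
  measurable_fun [set: T] g -> measurable_fun [set: T] h ->
  (\int[m]_z (`|f z - g z|)%:E <=
   \int[m]_z (`|f z - h z|)%:E + \int[m]_z (`|h z - g z|)%:E)%E.
Proof.
move=> mf mg mh; rewrite -ge0_integralD//=; last 2 first.
- exact: measurable_norm_sub.
- exact: measurable_norm_sub.
apply: ge0_le_integral => //=.
- exact: measurable_norm_sub.
- by apply: emeasurable_funD; exact: measurable_norm_sub.
- by move=> z _; rewrite -EFinD lee_fin ler_distD.
Qed.

Lemma lip_approx_closed f : measurable_fun [set: T] f ->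
  (forall eps : R, 0 < eps -> exists2 f', lip_approx f' &
    (\int[m]_z (`|f z - f' z|)%:E <= eps%:E)%E) -> lip_approx f.
Proof.
move=> mf h; split => // eps eps0.
have e2 : 0 < eps / 2 by rewrite divr_gt0.
have [f' [mf' hf'] ff'] := h _ e2; have [g [L [hg f'g]]] := hf' _ e2.
exists g, L; split => //.
have mg := lipschitz_circle_measurable hg.
by rewrite (le_trans (integral_norm_triangle mf mg mf'))// [eps]splitr EFinD leeD.
Qed.

Lemma lip_approxD f1 f2 : lip_approx f1 -> lip_approx f2 ->
  lip_approx (fun z => f1 z + f2 z).
Proof.
move=> [mf1 h1] [mf2 h2]; split; first exact: measurable_funD.
move=> eps eps0; have e2 : 0 < eps / 2 by rewrite divr_gt0.
have [g1 [L1 [hg1 i1]]] := h1 _ e2; have [g2 [L2 [hg2 i2]]] := h2 _ e2.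
exists (fun z => g1 z + g2 z), (L1 + L2); split.
  move=> z w; rewrite opprD addrACA mulrDl (le_trans (ler_normD _ _))//.
  by rewrite lerD.
have mg1 := lipschitz_circle_measurable hg1.
have mg2 := lipschitz_circle_measurable hg2.
apply: (@le_trans _ _ (\int[m]_z ((`|f1 z - g1 z|)%:E + (`|f2 z - g2 z|)%:E))%E).
  apply: ge0_le_integral => //=.
  - by apply: measurable_norm_sub; exact: measurable_funD.
  - by apply: emeasurable_funD; exact: measurable_norm_sub.
  - by move=> z _; rewrite -EFinD lee_fin opprD addrACA ler_normD.
rewrite ge0_integralD//=; [|exact: measurable_norm_sub|exact: measurable_norm_sub].
by rewrite [eps]splitr EFinD leeD.
Qed.

Lemma lip_approxZ (k : R) f : lip_approx f -> lip_approx (fun z => k * f z).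
Proof.
move=> [mf h]; split; first exact: measurable_funM.
move=> eps eps0; have e2 : 0 < eps / (`|k| + 1) by rewrite divr_gt0// ltr_wpDl.
have [g [L [hg i]]] := h _ e2.
exists (fun z => k * g z), (`|k| * L); split.
  by move=> z w; rewrite -mulrBr normrM -mulrA ler_wpM2l.
have mg := lipschitz_circle_measurable hg.
under eq_integral do rewrite -mulrBr normrM EFinM.
rewrite ge0_integralZl//=; last exact: measurable_norm_sub.
apply: (@le_trans _ _ (`|k|%:E * (eps / (`|k| + 1))%:E)%E).
  by rewrite lee_wpmul2l ?lee_fin.
rewrite -EFinM lee_fin mulrCA ger_pMr// ler_pdivrMr ?ltr_wpDl// mul1r.
by rewrite lerDl.
Qed.

Lemma lip_approx_cst (k : R) : lip_approx (fun=> k).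
Proof.
by apply: (@lip_approx_lipschitz 0) => z w; rewrite subrr normr0 mul0r.
Qed.

Lemma lip_approx_sum I (r : seq I) (F : I -> T -> R) :
  (forall i, lip_approx (F i)) -> lip_approx (fun z => \sum_(i <- r) F i z).
Proof.
move=> hF; elim: r => [|i r IH].
  rewrite (_ : (fun z => _) = fun=> 0); first exact: lip_approx_cst.
  by apply/funext => z; rewrite big_nil.
rewrite (_ : (fun z => _) = fun z => F i z + \sum_(j <- r) F j z).
  exact: lip_approxD.
by apply/funext => z; rewrite big_cons.
Qed.

Lemma lip_approx_lim (f_ : nat -> T -> R) f :
  (forall n, lip_approx (f_ n)) -> (forall n z, `|f_ n z| <= 1) ->
  (forall z, f_ n z @[n --> \oo] --> f z) -> lip_approx f.
Proof.
move=> hf h1 hc.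
have mf : measurable_fun [set: T] f.
  by apply: (@measurable_fun_cvg _ _ _ _ f_) => // n; case: (hf n).
apply: lip_approx_closed => // eps eps0.
have [|||||] := @dominated_convergence _ _ _ m [set: T] measurableT
  (fun n z => (f_ n z)%:E) (fun z => (f z)%:E) (fun=> 1%E).
- by move=> n; apply/measurable_EFinP; case: (hf n).
- exact/measurable_EFinP.
- by apply: aeW => z _; apply: cvg_EFin; [exact: nearW|exact: hc].
- exact: (finite_measure_integrable_cst _ 1).
- by apply: aeW => z n _; rewrite lee_fin.
move=> _ /fine_cvgP[[n1 _ hn1] /cvgrPdist_le /(_ _ eps0)[n2 _ hn2]] _.
pose n := maxn n1 n2; exists (f_ n) => //.
have /= fin := hn1 n (leq_maxl _ _); have /= hn := hn2 n (leq_maxr _ _).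
rewrite (_ : \int[m]_z _ = \int[m]_z (`|(f_ n z)%:E - (f z)%:E|))%E.
  rewrite -(fineK fin) lee_fin; move: hn; rewrite /= sub0r normrN; apply: le_trans.
  exact: ler_norm.
by apply: eq_integral => z _; rewrite distrC.
Qed.

(** Around a point of an open set, the distance to the complement is positive. *)
Lemma open_circle_ball A z : open A -> A z ->
  exists2 e : R, 0 < e & forall w, rnorm (circle_val z - circle_val w) < e -> A w.
Proof.
move=> [V oV <-] Vz.
have : nbhs (set_val z : R[i]^o) V by exact: open_nbhs_nbhs.
move=> /nbhs_ballP[e /= e0 he].
case: e e0 he => e e' /=; rewrite ltcE /= => /andP[/eqP -> e0] he.
exists e => // w zw; apply: he; rewrite -ball_normE /ball_ /=.
by rewrite -rnormE ltcR.
Qed.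

(** The indicator of an open set is the increasing limit of the functions
    [min 1 (n d)], with [d] the distance to the complement. *)
Lemma lip_approx_open A : open A -> lip_approx \1_A.
Proof.
move=> oA; have [[w0 Aw0]|A0] := pselect (exists w, ~ A w); last first.
  rewrite (_ : \1_A = fun=> 1); first exact: lip_approx_cst.
  apply/funext => z; rewrite indicE mem_set//.
  by apply: contrapT => nAz; apply: A0; exists z.
pose D z := [set rnorm (circle_val z - circle_val w) | w in ~` A].
pose d z := inf (D z).
have D0 z : D z !=set0 by exists (rnorm (circle_val z - circle_val w0)), w0.
have lbD z : lbound (D z) 0 by move=> _ [w _ <-]; exact: rnorm_ge0.
have hiD z : has_inf (D z) by split => //; exists 0.
have d0 z : 0 <= d z by apply: lb_le_inf.
have dlip z w : d z <= rnorm (circle_val z - circle_val w) + d w.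
  rewrite -lerBlDl; apply: lb_le_inf => // _ [v Av <-].
  rewrite lerBlDl (@le_trans _ _ (rnorm (circle_val z - circle_val v)))//.
    by apply: ge_inf; [exists 0|exists v].
  have -> : circle_val z - circle_val v = (circle_val z - circle_val w) +
    (circle_val w - circle_val v) by rewrite subrKA.
  exact: rnormD.
have dA z : ~ A z -> d z = 0.
  move=> nAz; apply/eqP; rewrite eq_le d0 andbT.
  by apply: ge_inf; [exists 0|exists z => //; rewrite subrr rnorm0].
have dA' z : A z -> 0 < d z.
  move=> Az; have [e e0 he] := open_circle_ball oA Az.
  apply: (lt_le_trans e0); apply: lb_le_inf => // _ [w nAw <-].
  by rewrite leNgt; apply/negP => /he.
apply: (@lip_approx_lim (fun n z => Num.min 1 (n%:R * d z))).
- move=> n; apply: (@lip_approx_lipschitz n%:R) => z w.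
  have h z' w' : Num.min 1 (n%:R * d z') - Num.min 1 (n%:R * d w') <=
      n%:R * rnorm (circle_val z' - circle_val w').
    have : n%:R * d z' <= n%:R * rnorm (circle_val z' - circle_val w') + n%:R * d w'.
      by rewrite -mulrDr ler_wpM2l.
    have : 0 <= n%:R * rnorm (circle_val z' - circle_val w').
      by rewrite mulr_ge0// rnorm_ge0.
    have [?|?] := leP 1 (n%:R * d z');
      have [?|?] := leP 1 (n%:R * d w'); lra.
  by rewrite ler_norml h andbT lerNl opprB rnormB h.
- move=> n z; rewrite ger0_norm; first by rewrite ge_min lexx.
  by rewrite le_min ler01 mulr_ge0.
- move=> z; rewrite indicE; have [Az|nAz] := boolP (z \in A); last first.
    rewrite dA; last by move=> Az; move/negP: nAz; apply; exact: mem_set.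
    under eq_cvg do rewrite mulr0 min_r//.
    exact: cvg_cst.
  move/set_mem: Az => /dA' dz.
  apply: cvg_near_cst; exists (Num.bound (d z)^-1) => // n /= hn.
  apply/min_l; rewrite -ler_pdivrMr// div1r.
  apply: (@le_trans _ _ (Num.bound (d z)^-1)%:R); last by rewrite ler_nat.
  by apply/ltW/archi_boundP; rewrite invr_ge0.
Qed.

(** Open sets are stable under intersection, and the sets whose indicator is
    approximable form a Dynkin system. *)
Lemma lip_approx_indic A : measurable A -> lip_approx \1_A.
Proof.
have GI : setI_closed (@open T) by move=> X Y; exact: openI.
have -> : measurable A = <<s (@open T) >> A by [].
rewrite -setI_closed_g_dynkin_g_sigma_algebra// => hA.
suff : (measurable `&` [set A | lip_approx \1_A]) A by case.
apply: hA; split; last first.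
  by move=> U oU; split; [exact: sub_sigma_algebra|exact: lip_approx_open].
split.
- split; first exact: measurableT.
  rewrite /= (_ : \1_[set: T] = fun=> 1); first exact: lip_approx_cst.
  by apply/funext => z; rewrite indicE mem_set.
- move=> B [mB hB]; split; first exact: measurableC.
  rewrite /= (_ : \1_(~` B) = fun z => 1 + (-1) * \1_B z).
    by apply: lip_approxD; [exact: lip_approx_cst|exact: lip_approxZ].
  apply/funext => z; rewrite !indicE in_setC; case: (_ \in _) => /=.
    by rewrite mulr1 subrr.
  by rewrite mulr0 addr0.
- move=> F tF hF; split; first by apply: bigcup_measurable => k _; case: (hF k).
  pose S n z := \sum_(i < n) (\1_(F i) z : R).
  have SE z : (exists2 k, (forall n, S n z = (k < n)%N%:R) &
      \1_(\bigcup_k F k) z = 1 :> R) \/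
      ((forall n, S n z = 0) /\ \1_(\bigcup_k F k) z = 0 :> R).
    have [[k Fk]|nF] := pselect (exists k, F k z).
      left; exists k; last by rewrite indicE mem_set//; exists k.
      have Fi i : \1_(F i) z = (i == k)%:R :> R.
        rewrite indicE; case: eqP => [->|ik]; first by rewrite mem_set.
        rewrite memNset// => Fiz; apply: ik; apply: tF => //.
        by exists z.
      elim=> [|n IH]; first by rewrite /S big_ord0.
      rewrite /S big_ord_recr /= -/(S n z) IH Fi [in RHS]ltnS [in RHS]leq_eqVlt [k == n]eq_sym.
      by case: eqP => [->|_]; rewrite ?ltnn ?add0r ?addr0.
    right; split; last by rewrite indicE memNset// => -[k _ Fk]; apply: nF; exists k.
    move=> n; rewrite /S big1// => i _; rewrite indicE memNset// => Fi.
    by apply: nF; exists i.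
  apply: (@lip_approx_lim S).
  + move=> n; rewrite /S.
    rewrite (_ : (fun z => _) = fun z => \sum_(i <- index_enum 'I_n) \1_(F i) z)//.
    by apply: lip_approx_sum => i; case: (hF i).
  + move=> n z; have [[k -> _]|[-> _]] := SE z; last by rewrite normr0.
    by case: (_ < _)%N; rewrite ?normr1 ?normr0.
  + move=> z; have [[k hk ->]|[h0 ->]] := SE z; apply: cvg_near_cst.
      by exists k.+1 => // n /= kn; rewrite hk kn.
    by exists 0%N.
Qed.

Import HBSimple.

Lemma lip_approx_integrable f : m.-integrable [set: T] (EFin \o f) -> lip_approx f.
Proof.
move=> fi; have /measurable_EFinP mf := measurable_int _ fi.
apply: lip_approx_closed => // eps eps0.
have [g [ig _ hg]] := approximation_sfun_integrable measurableT fi.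
have /fine_cvgP[[n1 _ hn1] /cvgrPdist_le /(_ _ eps0)[n2 _ hn2]] := hg.
pose n := maxn n1 n2; exists (g n).
  rewrite (_ : (g n : T -> R) = fun z => \sum_(y <- enum_fset (fset_set (range (g n))))
      (y * \1_(g n @^-1` [set y]) z)).
    apply: lip_approx_sum => y; apply: lip_approxZ; apply: lip_approx_indic.
    exact: measurable_funPTI.
  by apply/funext => z; rewrite fimfunE fsbig_finite.
have fin := hn1 n (leq_maxl _ _); have hn := hn2 n (leq_maxr _ _).
rewrite (_ : \int[m]_z _ = \int[m]_z (`|(EFin \o f) z - (g n z)%:E|))%E//.
rewrite -(fineK fin) lee_fin; move: hn; rewrite /= sub0r normrN; apply: le_trans.
exact: ler_norm.
Qed.

End lipschitz_density.

(** * Convergence of the Cesaro means in L^1 *)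

Section fejer_convergence.
Context {R : realType}.
Local Notation T := (circle R).
Local Notation m := (@circle_measure R).
Implicit Types (f g : T -> R[i]) (z w : T) (p : {poly R[i]}) (a : nat -> R[i]).

Lemma L1_lip_approx f : L1 f -> forall eps : R, 0 < eps -> exists g (L : R),
  (forall z w, rnorm (g z - g w) <= L * rnorm (circle_val z - circle_val w)) /\
  (norm_L1 (fun z => f z - g z)%R <= eps%:E)%E.
Proof.
move=> hf eps eps0; have e2 : 0 < eps / 2 by rewrite divr_gt0.
have iR := integrable_Re hf; have iI := integrable_Im hf.
have [mR /(_ _ e2)[g1 [L1' [hg1 i1]]]] := lip_approx_integrable iR.
have [mI /(_ _ e2)[g2 [L2 [hg2 i2]]]] := lip_approx_integrable iI.
exists (fun z => g1 z +i* g2 z), (L1' + L2); split.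
  move=> z w; rewrite (le_trans (rnorm_le_ReIm _))//= mulrDl lerD//.
have mg1 := lipschitz_circle_measurable hg1.
have mg2 := lipschitz_circle_measurable hg2.
apply: (@le_trans _ _ (\int[m]_z ((`|complex.Re (f z) - g1 z|)%:E +
    (`|complex.Im (f z) - g2 z|)%:E))%E).
  apply: ge0_le_integral => //=.
  - by move=> z _; rewrite lee_fin rnorm_ge0.
  - by apply: measurable_rnormE; apply: cmeasB; [exact: L1_cmeas|split].
  - by apply: emeasurable_funD; exact: measurable_norm_sub.
  - move=> z _; rewrite -EFinD lee_fin (le_trans (rnorm_le_ReIm _))//=.
    by case: (f z).
rewrite ge0_integralD//=; [|exact: measurable_norm_sub|exact: measurable_norm_sub].
by rewrite [eps]splitr EFinD leeD.
Qed.

(** Fejer's theorem in L^1. *)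
Lemma fejer_cvg_L1 f : L1 f -> forall eps : R, 0 < eps -> exists N0, forall N,
  (N0 <= N)%N -> (norm_L1 (fun z => f z - fejer N f z)%R <= eps%:E)%E.
Proof.
move=> hf eps eps0; have e3 : 0 < eps / 3 by rewrite divr_gt0.
have [g [L [hg fg]]] := L1_lip_approx hf e3.
have [N0 hN0] := fejer_lipschitz e3 hg.
have Lg := lipschitz_L1 hg.
exists N0 => N NN.
have mf := L1_cmeas hf; have mg := L1_cmeas Lg.
have mF (h : T -> R[i]) : cmeas (fejer N h) by apply: L1_cmeas; exact: L1_fejer.
apply: (le_trans (norm_L1_triangle (h := g) mf (mF f) mg)).
have -> : eps = eps / 3 + (eps / 3 + eps / 3) by field.
rewrite 2!EFinD leeD//.
apply: (le_trans (norm_L1_triangle (h := fejer N g) mg (mF f) (mF g))).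
rewrite leeD//.
  apply: (proj1 (@L1_bounded _ _ _ _ _)) => [|z]; first exact: cmeasB.
  by rewrite rnormB; exact: hN0.
have -> : (fun z => fejer N g z - fejer N f z) = fejer N (fun z => g z - f z).
  by apply/funext => z; rewrite fejerB.
apply: (le_trans (norm_fejer_le N (L1B Lg hf))).
by rewrite (norm_L1_distC g f).
Qed.

(** The Cesaro means of a power series, as polynomials. *)
Definition fejer_poly N a : {poly R[i]} := N.+1%:R^-1 *:
  \sum_(i < N.+1) \sum_(j < N.+1 | (j <= i)%N) a (i - j)%N *: 'X^(i - j).

Lemma fejer_polyE N f z : H1 f ->
  fejer N f z = (fejer_poly N (fun n => fourier f n%:Z)).[circle_val z].
Proof.
move=> [_ hneg]; rewrite hornerZ horner_sum; congr (_ * _).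
apply: eq_bigr => i _; rewrite horner_sum [RHS]big_mkcond /=.
apply: eq_bigr => j _; case: leqP => ij.
  by rewrite hornerZ hornerXn subzn.
by rewrite hneg ?mul0r// subr_lt0 ltz_nat.
Qed.

Lemma multp_fejer_poly N a (f : nat -> R[i]) :
  multp f (fejer_poly N a) = fejer_poly N (fun n => a n * f n).
Proof.
apply/polyP => n; rewrite coef_multp !coefZ -mulrA; congr (_ * _).
rewrite !coef_sum mulr_suml; apply: eq_bigr => i _.
rewrite !coef_sum mulr_suml; apply: eq_bigr => j _.
by rewrite !coefZ coefXn; case: eqP => [->|_]; rewrite ?mulr1// !mulr0 mul0r.
Qed.

Lemma fourier_horner p (n : int) :
  fourier (fun z => p.[circle_val z]) n = if n is Posz k then p`_k else 0.
Proof.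
rewrite fourierE (_ : (fun z => _) = fun z => \sum_(i < size p)
    p`_i * circle_val z ^ (i%:Z - n)); last first.
  apply/funext => z; rewrite horner_coef mulr_suml; apply: eq_bigr => i _.
  by rewrite -mulrA expfzDr ?circle_val_neq0.
rewrite cint_sum; last by move=> i; apply: L1Z; exact: L1_circleXz.
have E (i : 'I_(size p)) : cint (fun z => p`_i * circle_val z ^ (i%:Z - n)) =
    if i%:Z == n then p`_i else 0.
  rewrite cintZ ?cint_circleXz ?subr_eq0; last exact: L1_circleXz.
  by case: eqP => _; rewrite ?mulr1 ?mulr0.
under eq_bigr do rewrite E.
case: n {E} => k; last by rewrite big1.
have [kp|kp] := ltnP k (size p).
  rewrite (bigD1 (Ordinal kp))//= eqxx big1 ?addr0// => i ik.
  by case: eqP => // -[ik']; move: ik; rewrite -val_eqE /= ik' eqxx.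
rewrite nth_default// big1// => i _; case: eqP => // -[ik].
by move: (ltn_ord i); rewrite ik ltnNge kp.
Qed.

Lemma fourier_dist_le f g n : L1 f -> L1 g ->
  ((rnorm (fourier f n - fourier g n))%:E <= norm_L1 (fun z => f z - g z)%R)%E.
Proof.
move=> hf hg; rewrite -fourierB// fourierE.
rewrite (le_trans (rnorm_cint_le _))//; first by apply: L1_Xz; exact: L1B.
rewrite le_eqVlt; apply/orP; left; apply/eqP; apply: eq_integral => z _.
by rewrite rnormM rnorm_circleXz mulr1.
Qed.

End fejer_convergence.

(** * Completeness of L^1 *)

Section L1_completeness.
Context {R : realType}.
Local Notation T := (circle R).
Local Notation m := (@circle_measure R).

Lemma integrable_complete (u : nat -> T -> R) (A : R) : 0 <= A ->
  (forall n, m.-integrable [set: T] (EFin \o u n)) ->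
  (forall n, \int[m]_z (`|u n.+1 z - u n z|)%:E <= (A / (2 ^ n.+1)%:R)%:E)%E ->
  exists2 f : T -> R, m.-integrable [set: T] (EFin \o f) &
    forall eps : R, 0 < eps -> exists n0, forall n, (n0 <= n)%N ->
      (\int[m]_z (`|f z - u n z|)%:E <= eps%:E)%E.
Proof.
move=> A0 iu hu.
have mu n : measurable_fun [set: T] (u n).
  by have /measurable_EFinP := measurable_int _ (iu n).
pose d n z : \bar R := (`|u n.+1 z - u n z|)%:E.
have md n : measurable_fun [set: T] (d n) by exact: measurable_norm_sub.
have d0 n z : (0 <= d n z)%E by rewrite lee_fin.
pose S z := (\sum_(n <oo) d n z)%E.
have S0 z : (0 <= S z)%E by apply: nneseries_ge0.
have mS : measurable_fun [set: T] S by exact: ge0_emeasurable_sum.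
have iS : m.-integrable [set: T] S.
  apply/integrableP; split => //.
  under eq_integral do rewrite gee0_abs//.
  rewrite integral_nneseries//.
  apply: (@le_lt_trans _ _ A%:E); last exact: ltry.
  apply: le_trans (epsilon_trick0 xpredT A0).
  by apply: lee_nneseries => [n _ _|n _]; [exact: integral_ge0|exact: hu].
have Sfin : {ae m, forall z, [set: T] z -> S z \is a fin_num}.
  exact: integrable_ae iS.
(* the telescoping series converges wherever S is finite *)
have ucvg z : S z \is a fin_num -> cvgn (u ^~ z).
  move=> Sz; have -> : u ^~ z = fun n => u 0%N z + series (telescope (u ^~ z)) n.
    by apply/funext => n; rewrite -eq_sum_telescope.
  apply: is_cvgD; first exact: is_cvg_cst.
  apply: normed_cvg; apply: nondecreasing_is_cvgn.
    apply/nondecreasing_seqP => n; rewrite /normed_series_of !seriesEnat/=.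
    by rewrite big_nat_recr//= lerDl.
  exists (fine (S z)) => _ [n _ <-]; rewrite -lee_fin fineK//.
  rewrite /= seriesEnat /= -sumEFin.
  exact: (nneseries_lim_ge (u_ := d ^~ z)).
pose E := S @^-1` [set x | x \is a fin_num].
have mE : measurable E by rewrite -[E]setTI; exact: emeasurable_fin_num.
pose f z := limn (fun n => u n z * \1_E z).
have fE z : (fun n => u n z * \1_E z) @ \oo --> f z.
  have [Ez|nEz] := pselect (E z).
    rewrite /f indicE mem_set//; under eq_fun do rewrite mulr1.
    exact: ucvg.
  rewrite /f indicE memNset//; under eq_fun do rewrite mulr0.
  by rewrite lim_cst//; exact: cvg_cst.
have mf : measurable_fun [set: T] f.
  apply: (@measurable_fun_cvg _ _ _ _ (fun n z => u n z * \1_E z)) => //.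
    by move=> n; apply: measurable_funM.
have [|||||ifi hlim _] := @dominated_convergence _ _ _ m [set: T] measurableT
  (fun n z => (u n z)%:E) (fun z => (f z)%:E) (fun z => (`|u 0%N z|)%:E + S z)%E.
- by move=> n; exact/measurable_EFinP.
- exact/measurable_EFinP.
- apply: filterS Sfin => z /(_ Logic.I) Sz _.
  apply: cvg_EFin; first exact: nearW.
  have := fE z; rewrite indicE mem_set//; under eq_fun do rewrite mulr1.
  by [].
- apply: integrableD => //.
  have := integrable_abse (iu 0%N); apply: eq_integrable => // z _.
- apply: aeW => z n _; rewrite /=.
  have -> : u n z = u 0%N z + series (telescope (u ^~ z)) n.
    by rewrite -eq_sum_telescope.
  rewrite (@le_trans _ _ (`|u 0%N z| + `|series (telescope (u ^~ z)) n|)%:E)//.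
    by rewrite lee_fin ler_normD.
  rewrite EFinD leeD2l//.
  apply: (@le_trans _ _ (\sum_(0 <= i < n) d i z)%E).
    by rewrite seriesEnat sumEFin lee_fin ler_norm_sum.
  exact: nneseries_lim_ge.
exists f => // eps eps0.
move: hlim => /fine_cvgP[[n1 _ hn1] /cvgrPdist_le /(_ _ eps0)[n2 _ hn2]].
exists (maxn n1 n2) => n; rewrite geq_max => /andP[n1n n2n].
have /= fin := hn1 n n1n; have /= hn := hn2 n n2n.
rewrite (_ : \int[m]_z _ = \int[m]_z (`|(u n z)%:E - (f z)%:E|))%E.
  rewrite -(fineK fin) lee_fin; move: hn; rewrite sub0r normrN; apply: le_trans.
  exact: ler_norm.
by apply: eq_integral => z _; rewrite distrC.
Qed.

(** Completeness of L^1, for rapidly converging sequences. *)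
Lemma L1_complete (u : nat -> T -> R[i]) (A : R) : 0 <= A ->
  (forall n, L1 (u n)) ->
  (forall n, norm_L1 (fun z => u n.+1 z - u n z)%R <= (A / (2 ^ n.+1)%:R)%:E)%E ->
  exists2 f, L1 f & forall eps : R, 0 < eps -> exists n0, forall n, (n0 <= n)%N ->
      (norm_L1 (fun z => f z - u n z)%R <= eps%:E)%E.
Proof.
move=> A0 hu h.
have mu n := L1_cmeas (hu n).
have hR n : (\int[m]_z (`|complex.Re (u n.+1 z) - complex.Re (u n z)|)%:E <=
    (A / (2 ^ n.+1)%:R)%:E)%E.
  apply: le_trans (h n); apply: ge0_le_integral => //=.
  - by apply: measurable_norm_sub; [case: (mu n.+1)|case: (mu n)].
  - by apply: measurable_rnormE; exact: cmeasB.
  - move=> z _; rewrite lee_fin (le_trans _ (normRe_le_rnorm _))//.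
    by case: (u n.+1 z); case: (u n z).
have hI n : (\int[m]_z (`|complex.Im (u n.+1 z) - complex.Im (u n z)|)%:E <=
    (A / (2 ^ n.+1)%:R)%:E)%E.
  apply: le_trans (h n); apply: ge0_le_integral => //=.
  - by apply: measurable_norm_sub; [case: (mu n.+1)|case: (mu n)].
  - by apply: measurable_rnormE; exact: cmeasB.
  - move=> z _; rewrite lee_fin (le_trans _ (normIm_le_rnorm _))//.
    by case: (u n.+1 z); case: (u n z).
have [f1 if1 h1] := integrable_complete A0 (fun n => integrable_Re (hu n)) hR.
have [f2 if2 h2] := integrable_complete A0 (fun n => integrable_Im (hu n)) hI.
exists (fun z => f1 z +i* f2 z); first exact: L1_ReIm.
move=> eps eps0; have e2 : 0 < eps / 2 by rewrite divr_gt0.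
have [n1 hn1] := h1 _ e2; have [n2 hn2] := h2 _ e2.
exists (maxn n1 n2) => n; rewrite geq_max => /andP[n1n n2n].
have /measurable_EFinP mf1 := measurable_int _ if1.
have /measurable_EFinP mf2 := measurable_int _ if2.
have [mR mI] := mu n.
apply: (@le_trans _ _ (\int[m]_z ((`|f1 z - complex.Re (u n z)|)%:E +
    (`|f2 z - complex.Im (u n z)|)%:E))%E).
  apply: ge0_le_integral => //=.
  - by move=> z _; rewrite lee_fin rnorm_ge0.
  - by apply: measurable_rnormE; apply: cmeasB => //; split.
  - by apply: emeasurable_funD; exact: measurable_norm_sub.
  - move=> z _; rewrite -EFinD lee_fin (le_trans (rnorm_le_ReIm _))//=.
    by case: (u n z).
rewrite ge0_integralD//=; [|exact: measurable_norm_sub|exact: measurable_norm_sub].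
by rewrite [eps]splitr EFinD leeD ?hn1 ?hn2.
Qed.

End L1_completeness.

(** * Shifted multipliers on H^1 *)

Section shifted_multipliers.
Context {R : realType}.
Local Notation T := (circle R).
Local Notation m := (@circle_measure R).
Implicit Types (x : T -> R[i]) (y : nat -> T -> R[i]) (z w : T).

(** The supremum of a sequence is that of its finite maxima, which increase. *)
Lemma ereal_sup_running_max (u : nat -> R) : (forall k, 0 <= u k) ->
  ereal_sup (range (fun k => (u k)%:E)) =
  ereal_sup (range (fun K => (running_max u K)%:E)).
Proof.
move=> u0; apply/eqP; rewrite eq_le; apply/andP; split.
  apply: ge_ereal_sup => _ [k _ <-].
  apply: (@le_trans _ _ (running_max u k.+1)%:E).
    by rewrite lee_fin le_running_max.
  by apply: ereal_sup_ubound; exists k.+1.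
apply: ge_ereal_sup => _ [K _ <-].
have le k : ((u k)%:E <= ereal_sup (range (fun k => (u k)%:E)))%E.
  by apply: ereal_sup_ubound; exists k.
elim: K => [|K IH] /=; first by apply: le_trans (le 0%N); rewrite lee_fin.
by case: (leP (running_max u K) (u K)).
Qed.

Lemma integral_sup_le_running_max y (b : \bar R) : (forall k, cmeas (y k)) ->
  (forall K, (\int[m]_z (running_max (fun k => rnorm (y k z)) K)%:E <= b)%E) ->
  (integral_sup y <= b)%E.
Proof.
move=> my hb.
pose g K z := (running_max (fun k => rnorm (y k z)) K)%:E.
have gnd z : nondecreasing_seq (g ^~ z).
  by apply/nondecreasing_seqP => K; rewrite lee_fin /= le_max lexx.
have mg K : measurable_fun [set: T] (g K).
  apply/measurable_EFinP; apply: measurable_running_max => k.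
  exact: measurable_rnorm.
have g0 K z : (0 <= g K z)%E by rewrite lee_fin running_max_ge0.
have -> : integral_sup y = (\int[m]_z limn (g ^~ z))%E.
  apply: eq_integral => z _.
  rewrite ereal_sup_running_max; last by move=> k; exact: rnorm_ge0.
  by apply/esym/cvg_lim => //; exact: ereal_nondecreasing_cvgn.
rewrite monotone_convergence//.
apply: lime_le; last exact: nearW.
apply: ereal_nondecreasing_is_cvgn => K L KL; apply: ge0_le_integral => //.
by move=> z _; exact: gnd.
Qed.

Lemma fourier_mulXz (f : T -> R[i]) (j n : int) :
  fourier (fun z => circle_val z ^ j * f z) n = fourier f (n - j).
Proof.
rewrite !fourierE; congr cint; apply/funext => z.
by rewrite mulrAC -expfzDr ?circle_val_neq0// mulrC opprB.
Qed.

Section with_factorization.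
Variables (phi : nat -> R[i]) (c1 c2 c3 : R).
Hypotheses (c1_gt0 : 0 < c1) (c2_gt0 : 0 < c2) (c3_gt0 : 0 < c3).
Variable (F : factored phi c1 c2 c3).
Local Notation c := (c1 * c2 * c3).

(** The Cesaro means of the functions [y k] are the multiplied Cesaro means
    of [x]. *)
Lemma fejer_shifted x y N k z : H1 x -> shifted_series phi x y ->
  fejer N (y k) z = (multp (fun n => phi (n + k)%N)
    (fejer_poly N (fun n => fourier x n%:Z))).[circle_val z].
Proof.
move=> hx hy; have [hyk yE] := hy k.
rewrite fejer_polyE// multp_fejer_poly; congr (_.[_]).
by congr fejer_poly; apply/funext => n; exact: yE.
Qed.

Lemma norm_fejer_poly_le x N : H1 x ->
  (norm_L1 (fun z => (fejer_poly N (fun n => fourier x n%:Z)).[circle_val z])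
   <= norm_L1 x)%E.
Proof.
move=> hx; have [Lx _] := hx; apply: le_trans (norm_fejer_le N Lx).
rewrite le_eqVlt; apply/orP; left; apply/eqP; apply: eq_integral => z _.
by rewrite -fejer_polyE.
Qed.

Lemma integral_running_max_le x y K : H1 x -> shifted_series phi x y ->
  (\int[m]_z (running_max (fun k => rnorm (y k z)) K)%:E <= c%:E * norm_L1 x)%E.
Proof.
move=> hx hy; have [Lx _] := hx.
have Ly k : L1 (y k) by have [[]] := hy k.
have c0 : 0 <= c by rewrite ltW// !mulr_gt0.
apply/lee_addgt0Pr => eps eps0.
pose d : R := eps / K.+1%:R.
have d0 : 0 < d by rewrite divr_gt0.
have [Nk hNk] := choice (fun k => fejer_cvg_L1 (Ly k) d0).
pose N := (\max_(k < K) Nk k)%N.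
have hN (k : 'I_K) : (norm_L1 (fun z => y k z - fejer N (y k) z)%R <= d%:E)%E.
  by apply: hNk; exact: (leq_bigmax k).
set X := fejer_poly N (fun n => fourier x n%:Z).
have mF k : cmeas (fejer N (y k)) by apply: L1_cmeas; exact: L1_fejer.
have mD k : measurable_fun [set: T] (fun z => (rnorm (y k z - fejer N (y k) z))%:E).
  by apply: measurable_rnormE; apply: cmeasB => //; exact: L1_cmeas.
have mX : measurable_fun [set: T] (fun z => (max_shift phi K X z)%:E).
  by apply/measurable_EFinP; exact: measurable_max_shift.
apply: (@le_trans _ _ (\int[m]_z ((max_shift phi K X z)%:E +
    \sum_(k < K) (rnorm (y k z - fejer N (y k) z))%:E))%E).
  apply: ge0_le_integral => //=.
  - by move=> z _; rewrite lee_fin running_max_ge0.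
  - apply/measurable_EFinP; apply: measurable_running_max => k.
    by apply: measurable_rnorm; exact: L1_cmeas.
  - apply: emeasurable_funD => //; exact: emeasurable_sum.
  - move=> z _; rewrite sumEFin -EFinD lee_fin; apply: running_max_le.
      rewrite addr_ge0 ?max_shift_ge0// sumr_ge0// => k _; exact: rnorm_ge0.
    move=> k kK; rewrite -[y k z](subrK (fejer N (y k) z)) addrC.
    rewrite (le_trans (rnormD _ _))// lerD//.
      rewrite (fejer_shifted N k z hx hy).
      exact: (le_running_max
        (fun k => rnorm (multp (fun n => phi (n + k)%N) X).[circle_val z]) kK).
    rewrite (bigD1 (Ordinal kK))//= lerDl sumr_ge0// => j _.
    exact: rnorm_ge0.
rewrite ge0_integralD//=; last 3 first.
- by move=> z _; rewrite lee_fin max_shift_ge0.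
- by move=> z _; apply: sume_ge0 => k _; rewrite lee_fin rnorm_ge0.
- exact: emeasurable_sum.
apply: leeD.
  apply: (le_trans (max_shift_le c1_gt0 c2_gt0 c3_gt0 F K X)).
  by rewrite lee_wpmul2l ?lee_fin// norm_fejer_poly_le.
rewrite ge0_integral_sum//; last by move=> k z _; rewrite lee_fin rnorm_ge0.
apply: (@le_trans _ _ (\sum_(k < K) d%:E)%E); first by apply: lee_sum => k _; exact: hN.
rewrite sumEFin lee_fin sumr_const card_ord -mulr_natl /d mulrCA ger_pMr//.
by rewrite ler_pdivrMr// mul1r ler_nat.
Qed.

Lemma integral_sup_le x y : H1 x -> shifted_series phi x y ->
  (integral_sup y <= c%:E * norm_L1 x)%E.
Proof.
move=> hx hy; apply: integral_sup_le_running_max => [k|K].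
  by apply: L1_cmeas; have [[]] := hy k.
exact: integral_running_max_le.
Qed.

Lemma norm_multp_le p : (norm_L1 (fun z => (multp phi p).[circle_val z]) <=
  c%:E * norm_L1 (fun z => p.[circle_val z]))%E.
Proof.
apply: le_trans (max_shift_le c1_gt0 c2_gt0 c3_gt0 F 1 p).
rewrite le_eqVlt; apply/orP; left; apply/eqP; apply: eq_integral => z _.
rewrite /max_shift /= max_r ?rnorm_ge0//.
by congr ((rnorm (multp _ p).[_])%:E); apply/funext => n; rewrite addn0.
Qed.

(** The multiplied Cesaro means of [x] converge in L^1 along a subsequence. *)
Lemma multiplier_exists x : H1 x -> exists y : T -> R[i], multiplied phi x y.
Proof.
move=> hx; have [Lx xneg] := hx.
have c0 : 0 <= c by rewrite ltW// !mulr_gt0.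
have p2 j : 0 < 1 / (2 ^ j.+1)%:R :> R by rewrite divr_gt0// ltr0n expn_gt0.
have [M hM] := choice (fun j => fejer_cvg_L1 Lx (p2 j)).
pose N j := maxn (M j) j.
pose X j := fejer_poly (N j) (fun n => fourier x n%:Z).
have XE j : fejer (N j) x = fun z => (X j).[circle_val z].
  by apply/funext => z; rewrite fejer_polyE.
have hX j : (norm_L1 (fun z => x z - (X j).[circle_val z])%R <=
    (1 / (2 ^ j.+1)%:R)%:E)%E.
  by have := hM j (N j) (leq_maxl _ _); rewrite XE.
have mx := L1_cmeas Lx; have mX j := cmeas_horner (X j).
pose Y j z := (multp phi (X j)).[circle_val z].
have [j|j|f Lf hf] := @L1_complete _ Y (c * 2) (mulr_ge0 c0 (ler0n _ _)).
- exact: L1_horner.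
- have -> : (fun z => Y j.+1 z - Y j z) =
      (fun z => (multp phi (X j.+1 - X j)).[circle_val z]).
    by apply/funext => z; rewrite multpB hornerD hornerN.
  apply: (le_trans (norm_multp_le _)).
  have -> : (c * 2 / (2 ^ j.+1)%:R)%:E = (c%:E * (2 / (2 ^ j.+1)%:R)%:E)%E.
    by rewrite -EFinM mulrA.
  rewrite lee_wpmul2l ?lee_fin//.
  have -> : (fun z => (X j.+1 - X j).[circle_val z]) =
      (fun z => (X j.+1).[circle_val z] - (X j).[circle_val z]).
    by apply/funext => z; rewrite hornerD hornerN.
  apply: (le_trans (norm_L1_triangle (h := x) (mX _) (mX _) mx)).
  rewrite norm_L1_distC (le_trans (leeD (hX j.+1) (hX j)))// -EFinD lee_fin.
  have -> : 2 / (2 ^ j.+1)%:R = 1 / (2 ^ j.+1)%:R + 1 / (2 ^ j.+1)%:R :> R.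
    by rewrite -mulrDl.
  rewrite lerD2r !div1r lef_pV2 ?posrE ?ltr0n ?expn_gt0//.
  by rewrite ler_nat leq_exp2l.
have key (n : int) (t : R[i]) : (forall j, rnorm (fourier (Y j) n - t) <=
    c * rnorm (fourier (fun z => (X j).[circle_val z]) n - fourier x n)) ->
    fourier f n = t.
  move=> ht; apply/eqP; rewrite -subr_eq0; apply/eqP/rnorm_eq0/eqP.
  rewrite eq_le rnorm_ge0 andbT; apply/ler_addgt0Pr => e e0; rewrite add0r.
  have e2 : 0 < e / 2 by rewrite divr_gt0.
  have ec : 0 < e / 2 / (c + 1) by rewrite divr_gt0// ltr_wpDl.
  have [j1 h1] := hf _ e2; have [j2 h2] := fejer_cvg_L1 Lx ec.
  pose j := maxn j1 j2.
  have {}h1 := h1 j (leq_maxl _ _).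
  have {}h2 := h2 (N j) (leq_trans (leq_maxr j1 j2) (leq_maxr _ _)).
  have := le_trans (fourier_dist_le n Lf (L1_horner _)) h1; rewrite lee_fin => d1.
  rewrite XE in h2.
  have := le_trans (fourier_dist_le n Lx (L1_horner _)) h2; rewrite lee_fin rnormB => d2.
  have -> : fourier f n - t = (fourier f n - fourier (Y j) n) + (fourier (Y j) n - t).
    by rewrite subrKA.
  rewrite (le_trans (rnormD _ _))// [e]splitr lerD// (le_trans (ht j))//.
  apply: (@le_trans _ _ (c * (e / 2 / (c + 1)))); first by rewrite ler_wpM2l.
  by rewrite mulrCA ger_pMr// ler_pdivrMr ?ltr_wpDl// mul1r lerDl.
exists f; split; last first.
  move=> n; apply: key => j; rewrite !fourier_horner coef_multp -mulrBl rnormM mulrC.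
  by rewrite ler_wpM2r ?rnorm_ge0// (factored_bound c1_gt0 c2_gt0 F).
split => // n n0; apply: key => j.
case: n n0 => // n _; rewrite !fourier_horner subrr rnorm0 mulr_ge0 ?rnorm_ge0//.
Qed.

End with_factorization.

End shifted_multipliers.

(** * Representations through Hilbert spaces *)

Section representations.
Context {R : realType}.
Local Notation T := (circle R).
Local Notation C := (scalars_hilbert R).
Implicit Types (x : T -> R[i]) (y : nat -> T -> R[i]) (z w : T).

Lemma rnormZ (H : hilbert R) (a : R[i]) (v : H) : rnorm (a *: v) = rnorm a * rnorm v.
Proof. by apply: complexI; rewrite rmorphM /= !rnormE normrZ. Qed.

(** The supremum of the norms is a real number, which bounds the operators. *)
Lemma supnorm_real (H K : hilbert R) (xi : bounded_ops H K) :
  exists s : R, [/\ 0 <= s, supnorm xi = s%:E &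
    forall t v, rnorm (xi t v) <= s * rnorm v].
Proof.
have [M hM] := ops_bounded xi.
have le_sup t v : rnorm v <= 1 -> ((rnorm (xi t v))%:E <= supnorm xi)%E.
  move=> v1; apply: (@le_trans _ _ (opnorm (xi t))).
    by apply: ereal_sup_ubound; exists v.
  by apply: ereal_sup_ubound; exists t.
have sup0 : (0 <= supnorm xi)%E.
  by apply: le_trans (le_sup 0%N 0 _); rewrite ?lee_fin ?rnorm_ge0// rnorm0.
have supM : (supnorm xi <= `|M|%:E)%E.
  apply: ge_ereal_sup => _ [t _ <-]; apply: ge_ereal_sup => _ [v /= v1 <-].
  rewrite lee_fin (le_trans (hM t v))//.
  apply: (@le_trans _ _ (`|M| * rnorm v)); first by rewrite ler_wpM2r ?rnorm_ge0 ?ler_norm.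
  by rewrite ler_piMr.
have supfin : supnorm xi \is a fin_num.
  by rewrite ge0_fin_numE// (le_lt_trans supM)// ltry.
exists (fine (supnorm xi)); split; [exact: fine_ge0|by rewrite fineK|].
move=> t v; have [v0|v0] := eqVneq (rnorm v) 0.
  by rewrite (rnorm_eq0 v0) linear0 !rnorm0 mulr0.
have vgt0 : 0 < rnorm v by rewrite lt_def v0 rnorm_ge0.
pose a : R[i] := ((rnorm v)^-1)%:C.
have na : rnorm a = (rnorm v)^-1 by rewrite rnormR ger0_norm// invr_ge0 ltW.
have := le_sup t (a *: v); rewrite rnormZ na mulVf// lexx => /(_ isT).
rewrite linearZ /= rnormZ na -(fineK supfin) lee_fin.
by rewrite ler_pdivrMl// mulrC.
Qed.

(** Replacing the suprema by slightly larger numbers avoids divisions by 0. *)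
Lemma represents_factored (phi : nat -> R[i]) (xi : factors 2 C) :
  represents xi phi -> exists s1 s2 s3 : R,
  [/\ 0 <= s1, 0 <= s2, 0 <= s3, factors_norm xi = (s1 * s2 * s3)%:E &
    forall d : R, 0 < d -> inhabited (factored phi (s1 + d) (s2 + d) (s3 + d))].
Proof.
case: xi => K1 [xi1 [K2 [xi2 xi3]]] rep.
have [s1 [s10 e1 h1]] := supnorm_real xi1.
have [s2 [s20 e2 h2]] := supnorm_real xi2.
have [s3 [s30 e3 h3]] := supnorm_real xi3.
exists s1, s2, s3; split => //.
  by rewrite /= e1 e2 e3 -!EFinM mulrA.
move=> d d0; constructor.
have weak (s a b : R) : 0 <= b -> a <= s * b -> a <= (s + d) * b.
  by move=> b0 /le_trans; apply; rewrite ler_wpM2r// lerDl ltW.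
apply: (@Factored _ _ _ _ _ K1 K2 (fun t => xi1 t) (fun t => xi2 t) (fun t => xi3 t)).
- by move=> t v; apply: weak => //; exact: rnorm_ge0.
- by move=> t v; apply: weak => //; exact: rnorm_ge0.
- by move=> t v; apply: weak => //; exact: rnorm_ge0.
- move=> i j k; have := rep (fun n => nth 0%N [:: i; j; k] n).
  by rewrite !big_ord_recr big_ord0 /= add0n.
Qed.

Lemma integral_sup_le_factors_norm (phi : nat -> R[i]) (xi : factors 2 C) x y :
  represents xi phi -> H1 x -> shifted_series phi x y ->
  (integral_sup y <= factors_norm xi * norm_L1 x)%E.
Proof.
move=> /represents_factored[s1 [s2 [s3 [s10 s20 s30 -> hF]]]] hx hy.
have [Lx _] := hx; have rE := fineK (norm_L1_fin Lx).
have r0 : 0 <= fine (norm_L1 x) by rewrite fine_ge0// norm_L1_ge0.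
move: rE r0; set r := fine _ => rE r0; rewrite -rE -EFinM.
apply/lee_addgt0Pr => eps eps0.
pose Q : R := (s1 + 1) * (s2 + 1) * (s3 + 1).
have Q0 : 0 < Q by rewrite !mulr_gt0// ltr_wpDl.
pose d : R := Num.min 1 (eps / (Q * (r + 1))).
have Qr : 0 < Q * (r + 1) by rewrite mulr_gt0// ltr_wpDl.
have d0 : 0 < d by rewrite lt_min ltr01 divr_gt0.
have d1 : d <= 1 by rewrite ge_min lexx.
have dE : d * (Q * (r + 1)) <= eps by rewrite -ler_pdivlMr// ge_min lexx orbT.
have [F] := hF d d0.
have p1 : 0 < s1 + d by rewrite ltr_wpDl.
have p2 : 0 < s2 + d by rewrite ltr_wpDl.
have p3 : 0 < s3 + d by rewrite ltr_wpDl.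
apply: (le_trans (integral_sup_le p1 p2 p3 F hx hy)).
rewrite -rE -EFinM -EFinD lee_fin.
have le : (s1 + d) * (s2 + d) * (s3 + d) <= s1 * s2 * s3 + d * Q.
  have dd : d * d <= d by rewrite ler_piMr// ltW.
  have ddd : d * d * d <= d by rewrite (le_trans _ dd)// ler_piMr// mulr_ge0// ltW.
  have q1 : s1 * (d * d) <= s1 * d by rewrite ler_wpM2l.
  have q2 : s2 * (d * d) <= s2 * d by rewrite ler_wpM2l.
  have q3 : s3 * (d * d) <= s3 * d by rewrite ler_wpM2l.
  have q4 : 0 <= d * (s1 * s2 * s3) by rewrite !mulr_ge0// ltW.
  rewrite /Q; lra.
apply: (@le_trans _ _ ((s1 * s2 * s3 + d * Q) * r)); first by rewrite ler_wpM2r.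
rewrite mulrDl lerD2l (le_trans _ dE)// mulrA ler_wpM2l ?lerDl// mulr_ge0// ltW//.
Qed.

Lemma shift_H1 x k : H1 x -> H1 (fun z => circle_val z ^+ k * x z).
Proof.
move=> [Lx hx]; split.
  apply: (@L1M _ _ _ 1) => //; first exact/cmeasX/cmeas_circle_val.
  by move=> z; rewrite rnormX rnorm_circle expr1n.
move=> n n0; rewrite (fourier_mulXz x (Posz k) n) hx//.
by rewrite (lt_le_trans _ (lexx 0))// subr_lt0 (lt_le_trans n0).
Qed.

(** Multiplying the function M_phi (z ^ k x) by z ^ - k gives the function with
    coefficients x^(n) phi(n + k). *)
Lemma unshift_series (phi : nat -> R[i]) x y : H1 x ->
  (forall k, multiplied phi (fun z => circle_val z ^+ k * x z) (y k)) ->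
  shifted_series phi x (fun k z => circle_val z ^ (- k%:Z) * y k z).
Proof.
move=> [Lx hx] hy k; have [[Ly hneg] hpos] := hy k.
have E (n : int) : fourier (fun z => circle_val z ^ (- k%:Z) * y k z) n =
    fourier (y k) (n + k%:Z) by rewrite fourier_mulXz opprK.
have E' (l : nat) : fourier (y k) l%:Z = fourier x (l%:Z - k%:Z) * phi l.
  by rewrite hpos (fourier_mulXz x (Posz k)).
split; last by move=> n; rewrite E -PoszD E' PoszD addrK.
split.
  apply: (@L1M _ _ _ 1) => //; first exact: cmeas_circleXz.
  by move=> z; rewrite rnorm_circleXz.
move=> n n0; rewrite E; case nk : (n + k%:Z) => [l|l]; last exact: hneg.
by rewrite E' hx ?mul0r// -nk addrK.
Qed.

End representations.

Theorem lemma2p3 (R : realType) (phi : nat -> R[i]) (hphi : M_space 3 phi) :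
  shift_bounded phi /\
  (ereal_sup [set integral_sup y | y in
     [set y : nat -> circle R -> R[i] |
       exists2 x, ball_H1 x & shifted_series phi x y]]
   <= M_norm 3 phi)%E.
Proof.
split.
  have [_ [xi rep _]] := hphi; move=> x hx shift; split.
    move=> k; have [s1 [s2 [s3 [s10 s20 s30 _ hF]]]] := represents_factored rep.
    have [F] := hF 1 ltr01.
    by apply: (multiplier_exists _ _ _ F); rewrite ?ltr_wpDl//; exact: shift_H1.
  move=> y hy; pose y' k z := circle_val z ^ (- k%:Z) * y k z.
  have -> : integral_sup y = integral_sup y'.
    apply: eq_integral => z _.
    have -> // : (fun k => (rnorm (y k z))%:E) = (fun k => (rnorm (y' k z))%:E).
    by apply/funext => k; rewrite /y' rnormM rnorm_circleXz mul1r.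
  have := integral_sup_le_factors_norm rep hx (unshift_series hx hy).
  move/le_lt_trans; apply.
  have [s1 [s2 [s3 [_ _ _ -> _]]]] := represents_factored rep.
  have [Lx _] := hx.
  by rewrite -(fineK (norm_L1_fin Lx)) -EFinM ltry.
apply: ge_ereal_sup => _ [y [x [hx x1] hy] <-].
apply: le_ereal_inf_tmp => _ [xi rep ->].
apply: (le_trans (integral_sup_le_factors_norm rep hx hy)).
have [s1 [s2 [s3 [s10 s20 s30 -> _]]]] := represents_factored rep.
by rewrite -[leRHS]mule1 lee_wpmul2l// lee_fin !mulr_ge0.
Qed.
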